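(* If $G$ is a positive definite block Toeplitz matrix with entries $g_{ij}=h_{i-j}\in\mathbb{C}^{p\times p}$ for $i,j=0,\ldots,n$, if $E_+(\lambda)=F(\lambda)\mathfrak{u}_0$ and $\Delta_{\mathfrak{E}}(t)=(E_+(e^{it})E_+(e^{it})^* )^{-1}$, then $$\frac{1}{2\pi}\int_0^{2\pi}e^{-ikt}\Delta_{\mathfrak{E}}(t)\,dt=h_k\quad\text{for } k=0,\pm1,\ldots,\pm n.$$ Thus, $\sigma(t)=\int_0^t\Delta_{\mathfrak{E}}(s)\,ds$ is a solution of the truncated matrix trigonometric moment problem for $h_{-n},\ldots,h_n$.
   Context: $p,n\ge1$ are fixed integers, $m=(n+1)p$, $F(\lambda)=\begin{bmatrix}I_p&\lambda I_p&\cdots&\lambda^nI_p\end{bmatrix}$, $\Gamma=G^{-1}\in\mathbb{C}^{m\times m}$, $\mathfrak{e}_0=\begin{bmatrix}I_p&0&\cdots&0\end{bmatrix}^T\in\mathbb{C}^{m\times p}$, $\gamma_{00}^{(n)}=\mathfrak{e}_0^*\Gamma\mathfrak{e}_0$ and $\mathfrak{u}_0=\Gamma\mathfrak{e}_0(\gamma_{00}^{(n)})^{-1/2}$. A nondecreasing $p\times p$ matrix valued function $\sigma$ on $[0,2\pi]$ is a solution of the truncated matrix trigonometric moment problem for $h_{-n},\ldots,h_n$ if $\frac{1}{2\pi}\int_0^{2\pi}e^{-ikt}\,d\sigma(t)=h_k$ for $k=-n,\ldots,n$. *)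

(* Defs.v *)
From HB Require Import structures.
From mathcomp Require Import all_boot all_order all_algebra.
From mathcomp Require Import complex.
From mathcomp Require Import all_classical all_reals all_analysis.

Set Implicit Arguments.
Unset Strict Implicit.
Unset Printing Implicit Defensive.

Import Order.TTheory GRing.Theory Num.Theory.
Import numFieldNormedType.Exports.

Local Open Scope ring_scope.
Local Open Scope complex_scope.
Local Open Scope sesquilinear_scope.
Local Open Scope classical_set_scope.

Definition possemidefmx (C : numClosedFieldType) (k : nat) (A : 'M[C]_k) : Prop :=
  A \is hermsymmx /\ forall v : 'cV[C]_k, 0 <= (v ^t* *m A *m v) 0 0.

Definition posdefmx (C : numClosedFieldType) (k : nat) (A : 'M[C]_k) : Prop :=
  A \is hermsymmx /\
  forall v : 'cV[C]_k, v != 0 -> 0 < (v ^t* *m A *m v) 0 0.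

(* A ^ (-1/2) by functional calculus: [spectralmx A] is a unitary U with
   A = U^* diag(d) U whenever A is normal. See [invsqrtmxP]. *)
Definition invsqrtmx (C : numClosedFieldType) (k : nat) (A : 'M[C]_k) : 'M[C]_k :=
  (spectralmx A) ^t* *m diag_mx (map_mx (fun x => (sqrtC x)^-1) (spectral_diag A))
    *m spectralmx A.

Lemma invsqrtmxP (C : numClosedFieldType) (k : nat) (A : 'M[C]_k) :
  posdefmx A ->
  posdefmx (invsqrtmx A) /\ invsqrtmx A *m invsqrtmx A = invmx A.
Proof.
move=> [hA pA]; rewrite /invsqrtmx.
have := orthomx_spectralP (hermitian_normalmx hA).
have Uu := spectral_unitarymx A; rewrite (invmx_unitary Uu).
set U := spectralmx A in Uu *; set d := spectral_diag A => eA.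
have UUt : U *m U ^t* = 1%:M by apply/unitarymxP.
have UtU : U ^t* *m U = 1%:M by apply: mulmx1C.
have diagE (e : 'rV[C]_k) (w : 'cV[C]_k) :
    (w ^t* *m diag_mx e *m w) 0 0 = \sum_i e 0 i * `|w i 0| ^+ 2.
  rewrite mul_mx_diag !mxE; apply: eq_bigr => i _.
  by rewrite !mxE normCK mulrAC mulrC [w i 0 * _]mulrC.
have UvE (e : 'rV[C]_k) (v : 'cV[C]_k) :
    v ^t* *m (U ^t* *m diag_mx e *m U) *m v
    = (U *m v) ^t* *m diag_mx e *m (U *m v).
  by rewrite trmx_mul map_mxM !mulmxA.
have Uv0 (v : 'cV[C]_k) : v != 0 -> U *m v != 0.
  by apply: contra_neq => Uv0; rewrite -[v]mul1mx -UtU -mulmxA Uv0 mulmx0.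
have d_gt0 i : 0 < d 0 i.
  pose w : 'cV[C]_k := delta_mx i 0.
  have w0 : U ^t* *m w != 0.
    apply/eqP => /(congr1 (mulmx U)); rewrite mulmxA UUt mul1mx mulmx0.
    by move=> /matrixP/(_ i 0); rewrite !mxE !eqxx => /eqP; rewrite oner_eq0.
  have := pA _ w0; rewrite eA UvE [U *m (_ *m w)]mulmxA UUt mul1mx diagE (bigD1 i) //= big1.
    by rewrite addr0 !mxE !eqxx normr1 expr1n mulr1.
  by move=> j ji; rewrite !mxE (negPf ji) normr0 expr0n mulr0.
have r_gt0 i : 0 < (sqrtC (d 0 i))^-1 by rewrite invr_gt0 sqrtC_gt0.
split; [split|].
- apply/is_hermitianmxP; rewrite expr0 scale1r !trmx_mul !map_mxM.
  rewrite tr_diag_mx map_diag_mx trmxCK mulmxA.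
  congr (_ *m diag_mx _ *m _); apply/rowP => i; rewrite !mxE.
  by apply/esym/CrealP; rewrite ger0_real // ltW.
- move=> v /Uv0 v0; rewrite UvE diagE.
  have [i wi|w0] := pickP (fun i => (U *m v) i 0 != 0); last first.
    case/eqP: v0; apply/colP => i; have /negbFE := w0 i.
    by move=> /eqP ->; rewrite mxE.
  rewrite (bigD1 i) //= ltr_pwDl //.
    by rewrite [X in X * _]mxE mulr_gt0 ?exprn_gt0 ?normr_gt0.
  by apply: sumr_ge0 => j _; rewrite [X in X * _]mxE mulr_ge0 ?exprn_ge0 // ltW.
- set e := map_mx (fun x => (sqrtC x)^-1) d.
  have -> : U ^t* *m diag_mx e *m U *m (U ^t* *m diag_mx e *m U) =
      U ^t* *m (diag_mx e *m diag_mx e) *m U.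
    by rewrite !mulmxA -[_ *m U *m U ^t*]mulmxA UUt mulmx1.
  set B := LHS.
  have AB : A *m B = 1%:M.
    rewrite eA /B !mulmxA -[_ *m U *m U ^t*]mulmxA UUt mulmx1.
    suff -> : U ^t* *m diag_mx d *m diag_mx e *m diag_mx e = U ^t* by [].
    rewrite -!mulmxA !mulmx_diag.
    suff -> : (\row_j (d 0 j * (\row_j0 (e 0 j0 * e 0 j0)) 0 j)) = const_mx 1.
      by rewrite diag_const_mx mulmx1.
    apply/rowP => j; rewrite !mxE -invfM -expr2 sqrtCK mulfV //.
    by rewrite gt_eqF.
  have [uA _] := mulmx1_unit AB.
  by rewrite -[B]mul1mx -(mulVmx uA) -mulmxA AB mulmx1.
Qed.

Section BlockToeplitz.
Variables (R : realType) (p n : nat).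
Local Notation C := R[i].
(* (n + 1) * p, in the shape of the library's block matrices *)
Local Notation m := (\sum_(i < n.+1) p)%N.

Definition block_toeplitz (h : int -> 'M[C]_p) : 'M[C]_m :=
  \mxblock_(i < n.+1, j < n.+1) h ((i : nat)%:Z - (j : nat)%:Z).

Definition Fmx (l : C) : 'M[C]_(p, m) :=
  \mxrow_(j < n.+1) ((l ^+ j)%:M : 'M[C]_p).

Definition e0mx : 'M[C]_(m, p) :=
  \mxcol_(i < n.+1) (if i == ord0 then 1%:M else 0 : 'M[C]_p).

Definition gamma00 (G : 'M[C]_m) : 'M[C]_p := e0mx ^t* *m invmx G *m e0mx.

Definition u0mx (G : 'M[C]_m) : 'M[C]_(m, p) :=
  invmx G *m e0mx *m invsqrtmx (gamma00 G).

Definition Eplus (G : 'M[C]_m) (l : C) : 'M[C]_p := Fmx l *m u0mx G.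

Definition expi (t : R) : C := cos t +i* sin t.

Definition DeltaE (G : 'M[C]_m) (t : R) : 'M[C]_p :=
  invmx (Eplus G (expi t) *m (Eplus G (expi t)) ^t*).

End BlockToeplitz.

Section MatrixIntegrals.
Variables (R : realType) (p : nat).
Local Notation C := R[i].
Local Notation mu := (@lebesgue_measure R).

(* Matrix-valued functions are integrated entrywise, and complex-valued ones
   through their real and imaginary parts. *)
Definition mx_integrable (D : set R) (f : R -> 'M[C]_p) : Prop :=
  forall i j,
    mu.-integrable D (fun t => (complex.Re (f t i j))%:E) /\
    mu.-integrable D (fun t => (complex.Im (f t i j))%:E).

Definition mx_integral (D : set R) (f : R -> 'M[C]_p) : 'M[C]_p :=
  \matrix_(i, j) ((\int[mu]_(t in D) complex.Re (f t i j)) +i*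
                  (\int[mu]_(t in D) complex.Im (f t i j))).

Definition mx_nondecreasing (a b : R) (sigma : R -> 'M[C]_p) : Prop :=
  forall s t, a <= s -> s <= t -> t <= b -> possemidefmx (sigma t - sigma s).

(* Riemann-Stieltjes integral: [I] is the limit, as the mesh tends to 0, of the
   sums over the subdivisions a < s_0 < ... = b tagged by the points [xi k]. *)
Definition is_RS_integral (a b : R) (f : R -> C) (sigma : R -> 'M[C]_p)
    (I : 'M[C]_p) : Prop :=
  forall e : R, 0 < e -> exists2 d : R, 0 < d &
  forall (s : seq R) (xi : nat -> R),
    let x := nth b (a :: s) in
    itv_partition a b s ->
    (forall k, (k < size s)%N -> x k <= xi k <= x k.+1 /\ x k.+1 - x k < d) ->
    forall i j,
      `|(\sum_(k < size s) f (xi k) *: (sigma (x k.+1) - sigma (x k))) i j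
        - I i j| < e%:C.

Definition trig_moment_solution (n : nat) (h : int -> 'M[C]_p)
    (sigma : R -> 'M[C]_p) : Prop :=
  mx_nondecreasing 0 (2 * pi) sigma /\
  forall k : int, - n%:Z <= k <= n%:Z ->
    exists2 I : 'M[C]_p,
      is_RS_integral 0 (2 * pi) (fun t => expi (- (k%:~R * t))) sigma I &
      ((2 * pi)^-1)%:C *: I = h k.

End MatrixIntegrals.

(* Main.v *)
Require Import Defs.
From HB Require Import structures.
From mathcomp Require Import all_boot all_order all_algebra.
From mathcomp Require Import complex.
From mathcomp Require Import all_classical all_reals all_analysis.
From mathcomp Require Import ring lra.
Import Order.TTheory GRing.Theory Num.Theory.
Import numFieldNormedType.Exports.
Local Open Scope ring_scope.
Local Open Scope complex_scope.
Local Open Scope sesquilinear_scope.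
Local Open Scope classical_set_scope.

Set Implicit Arguments.
Unset Strict Implicit.

(** Write [e] for the first block column of the identity, [g = e^* G^-1 e], and
    [S] for the block shift that sends the [(i+1)]-st block coordinate vector to
    the [i]-th one and kills [e].  Let [Pi = 1 - G^-1 e g^-1 e^*], the
    [G]-orthogonal projection onto the vectors whose first block is zero, and
    let [B = S Pi].  This [B] is the companion matrix of the matrix polynomial
    [P(l) = F(l) G^-1 e], and everything is read off from it.

    That [G] is Toeplitz says that [S] preserves the form [G] on vectors with
    zero first block.  As [Pi] produces such vectors, [B] satisfies the Stein
    equation [G - B^* G B = e g^-1 e^*] ([companion_stein]), and the rows of [G]
    satisfy [e_i^* G B = e_(i+1)^* G] ([companion_shift]).

    On the unit circle [1 - l B] is invertible ([companion_resolvent_unit]).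
    With [R = (1 - l B)^-1], the Stein equation becomes
    [G R + R^* G - G = R^* e g^-1 e^* R] ([resolvent_stein]), while
    [F(l) - l F(l) S = e^*] gives [e^* R e = g P(l)^-1]
    ([resolvent_corner]).  Hence the density is the first diagonal block
    [e^* (G R + R^* G - G) e] ([corner_spectral_density]).

    It remains to find the Fourier coefficients [I_k] of [t |-> R(e^(it))].
    Integrating [R = 1 + l B R] against the characters shows that
    [I_k = B I_(k-1)] for [k <> 0].  The coefficients of negative index thus form
    a bounded backward orbit of [B], and only the zero orbit is bounded, because
    the Stein equation makes [B] lose energy ([bounded_backward_orbit_eq0]).  So
    [I_k] vanishes for [k < 0], is [2 pi] for [k = 0], and for [0 <= k <= n] the
    shift relation yields [e^* G I_k e = 2 pi e_k^* G e = 2 pi h_k]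
    ([resolvent_moment]).

    The Riemann-Stieltjes part follows because the characters are Lipschitz and
    the density is continuous, hence bounded ([is_RS_integral_primitive]). *)

(** * Adjoints and positive definite matrices *)

Section Adjoint.
Variable C : numClosedFieldType.

Lemma adjmxM k l q (A : 'M[C]_(k, l)) (B : 'M[C]_(l, q)) :
  (A *m B) ^t* = B ^t* *m A ^t*.
Proof. by rewrite trmx_mul map_mxM. Qed.

Lemma adjmxB k l (A B : 'M[C]_(k, l)) : (A - B) ^t* = A ^t* - B ^t*.
Proof. by rewrite linearB /= map_mxB. Qed.

Lemma adjmxZ k l (a : C) (A : 'M[C]_(k, l)) : (a *: A) ^t* = a^* *: A ^t*.
Proof. by rewrite linearZ /= map_mxZ. Qed.

Lemma adjmx1 k : (1%:M : 'M[C]_k) ^t* = 1%:M.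
Proof. by rewrite trmx1 map_mx1. Qed.

Lemma adjmx_sum k l q (A : 'I_q -> 'M[C]_(k, l)) :
  (\sum_(i < q) A i) ^t* = \sum_(i < q) (A i) ^t*.
Proof.
apply/matrixP => i j; rewrite !mxE !summxE rmorph_sum.
by apply: eq_bigr => r _; rewrite !mxE.
Qed.

Lemma hermsymmxP k (A : 'M[C]_k) : reflect (A ^t* = A) (A \is hermsymmx).
Proof.
by apply: (iffP (is_hermitianmxP _ _ _)); rewrite expr0 scale1r => /esym.
Qed.

Lemma quad_sqr k l (A : 'M[C]_(l, k)) (v : 'cV[C]_k) :
  (v ^t* *m (A ^t* *m A) *m v) 0 0 = \sum_i `|(A *m v) i 0| ^+ 2.
Proof.
rewrite mulmxA -mulmxA -adjmxM mxE; apply: eq_bigr => i _.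
by rewrite !mxE normCK mulrC.
Qed.

Lemma posdefmx_ge0 k (A : 'M[C]_k) (v : 'cV[C]_k) :
  posdefmx A -> 0 <= (v ^t* *m A *m v) 0 0.
Proof.
move=> [_ pA]; have [->|/pA/ltW//] := eqVneq v 0.
by rewrite mulmx0 mxE.
Qed.

Lemma posdefmx_eq0 k (A : 'M[C]_k) (v : 'cV[C]_k) :
  posdefmx A -> (v ^t* *m A *m v) 0 0 = 0 -> v = 0.
Proof.
move=> [_ pA] v0; apply/eqP/negPn/negP => /pA.
by rewrite v0 ltxx.
Qed.

Lemma mulmx_inj0_unit k (A : 'M[C]_k) :
  (forall v : 'cV[C]_k, A *m v = 0 -> v = 0) -> A \in unitmx.
Proof.
move=> Ainj; rewrite -unitmx_tr -row_free_unit -kermx_eq0.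
apply/eqP/row_matrixP => i; rewrite row0; apply: trmx_inj; rewrite trmx0.
apply: Ainj; apply: trmx_inj.
by rewrite trmx_mul trmxK -row_mul mulmx_ker row0 trmx0.
Qed.

Lemma posdefmx_unit k (A : 'M[C]_k) : posdefmx A -> A \in unitmx.
Proof.
move=> pA; apply: mulmx_inj0_unit => v Av0; apply: (posdefmx_eq0 pA).
by rewrite -mulmxA Av0 mulmx0 mxE.
Qed.

Lemma adjmx_inv k (A : 'M[C]_k) : (invmx A) ^t* = invmx (A ^t*).
Proof. by rewrite trmx_inv map_invmx. Qed.

Lemma posdefmx_inv k (A : 'M[C]_k) : posdefmx A -> posdefmx (invmx A).
Proof.
move=> pA; have uA := posdefmx_unit pA; have [/hermsymmxP hA qA] := pA.
split; first by apply/hermsymmxP; rewrite adjmx_inv hA.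
move=> v v0; have := qA (invmx A *m v); rewrite adjmxM adjmx_inv hA.
rewrite -!mulmxA (mulmxA A) mulmxV // mul1mx; apply.
by apply: contra_neq v0 => v0; rewrite -[v](mulKVmx uA) v0 mulmx0.
Qed.

Lemma posdefmx_conj k l (A : 'M[C]_k) (T : 'M[C]_(k, l)) :
  (forall v : 'cV[C]_l, T *m v = 0 -> v = 0) ->
  posdefmx A -> posdefmx (T ^t* *m A *m T).
Proof.
move=> Tinj [/hermsymmxP hA qA]; split.
  by apply/hermsymmxP; rewrite !adjmxM hA trmxCK mulmxA.
move=> v v0; rewrite !mulmxA -adjmxM -mulmxA; apply: qA.
by apply: contra_neq v0 => /Tinj.
Qed.

Lemma sum_adj_congr k l q (Y X : 'I_q -> 'M[C]_(k, l)) (A : 'M[C]_k) :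
  (forall a b, (Y a) ^t* *m A *m Y b = (X a) ^t* *m A *m X b) ->
  (\sum_a Y a *m (X a) ^t*) ^t* *m A *m (\sum_b Y b *m (X b) ^t*)
  = (\sum_a X a *m (X a) ^t*) *m A *m (\sum_b X b *m (X b) ^t*).
Proof.
move=> YX; rewrite adjmx_sum !mulmx_suml; apply: eq_bigr => a _.
rewrite !mulmx_sumr; apply: eq_bigr => b _; rewrite adjmxM trmxCK.
have := congr1 (fun Z => X a *m Z *m (X b) ^t*) (YX a b).
by rewrite !mulmxA.
Qed.

End Adjoint.

(** * Block coordinates and the block shift *)

Section BlockCoordinates.
Variables (C : numClosedFieldType) (p n : nat).
Local Notation m := (\sum_(i < n.+1) p)%N.

(** Indexing by [nat] makes [blockcol i] vanish for [i > n], so that shift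
    identities need no boundary case. *)
Definition blockcol (i : nat) : 'M[C]_(m, p) :=
  \mxcol_(k < n.+1) (if k == i :> nat then 1%:M else 0 : 'M[C]_p).

Definition blockshift : 'M[C]_m :=
  \sum_(l < n) blockcol l *m (blockcol l.+1) ^t*.

Local Notation E := blockcol.
Local Notation S := blockshift.

Lemma adj_blockcol i :
  (E i) ^t* = \mxrow_(k < n.+1) (if k == i :> nat then 1%:M else 0 : 'M[C]_p).
Proof.
rewrite /blockcol tr_mxcol; apply/matrixP => a b; rewrite !mxE.
by case: ifP => _; rewrite !mxE ?rmorph_nat ?rmorph0 // eq_sym.
Qed.

Lemma mul_adj_blockcol i j :
  (E i) ^t* *m E j = if (i == j) && (i < n.+1)%N then 1%:M else 0.
Proof.
rewrite adj_blockcol /blockcol mul_mxrow_mxcol.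
have [lin|nin] := ltnP i n.+1; last first.
  rewrite andbF big1 // => k _; case: eqP => [ki|_]; last by rewrite mul0mx.
  by move: (ltn_ord k); rewrite ki ltnNge nin.
rewrite (bigD1 (Ordinal lin)) //= eqxx big1 ?addr0 => [|k]; last first.
  by rewrite -val_eqE /= => /negPf->; rewrite mul0mx.
by rewrite andbT; case: eqP => _; rewrite ?mulmx1 ?mulmx0.
Qed.

Lemma sum_blockcol_adj : \sum_(i < n.+1) E i *m (E i) ^t* = 1%:M.
Proof.
transitivity (\sum_(i < n.+1) \mxblock_(k < n.+1, l < n.+1)
   (if (k == i) && (l == i) then 1%:M else 0 : 'M[C]_p)).
  apply: eq_bigr => i _; rewrite adj_blockcol mul_mxcol_mxrow.
  apply: eq_mxblock => k l; rewrite !val_eqE.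
  by case: eqP; case: eqP => _ _; rewrite ?mul1mx ?mulmx0 ?mul0mx.
rewrite -mxblock_sum -[RHS]submxblockK; apply: eq_mxblock => k l.
rewrite (bigD1 k) //= eqxx big1 ?addr0 => [|i ik]; last first.
  by rewrite eq_sym (negPf ik).
apply/matrixP => a b; rewrite !mxE.
rewrite -(val_eqE (tagnat.Rank k a)) /= tagnat.eq_Rank.
rewrite /= [l == k]eq_sym; have [_|kl] := eqVneq k l; rewrite !mxE //.
Qed.

Lemma blockcol_ext q (A : 'M[C]_(m, q)) :
  (forall i, (i < n.+1)%N -> (E i) ^t* *m A = 0) -> A = 0.
Proof.
move=> A0; rewrite -[A]mul1mx -sum_blockcol_adj mulmx_suml.
apply: big1 => i _; by rewrite -mulmxA A0 // mulmx0.
Qed.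

Lemma adj_blockcol_mxcol q (A : 'I_n.+1 -> 'M[C]_(p, q)) (i : 'I_n.+1) :
  (E i) ^t* *m (\mxcol_(k < n.+1) A k) = A i.
Proof.
rewrite adj_blockcol mul_mxrow_mxcol (bigD1 i) //= eqxx mul1mx big1 ?addr0 //.
by move=> k /negPf; rewrite -val_eqE /= => ->; rewrite mul0mx.
Qed.

Lemma mxrow_blockcol q (A : 'I_n.+1 -> 'M[C]_(q, p)) (i : 'I_n.+1) :
  (\mxrow_(k < n.+1) A k) *m E i = A i.
Proof.
rewrite /blockcol mul_mxrow_mxcol (bigD1 i) //= eqxx mulmx1 big1 ?addr0 //.
by move=> k /negPf; rewrite -val_eqE /= => ->; rewrite mulmx0.
Qed.

Lemma adj_blockcol_toeplitz (h : int -> 'M[C]_p) i j :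
  (i < n.+1)%N -> (j < n.+1)%N ->
  (E i) ^t* *m (\mxblock_(k < n.+1, l < n.+1) h (k%:Z - l%:Z)) *m E j
  = h (i%:Z - j%:Z).
Proof.
move=> li lj; rewrite mxblockEv.
rewrite (adj_blockcol_mxcol _ (Ordinal li)).
by rewrite (mxrow_blockcol _ (Ordinal lj)).
Qed.

Lemma blockcol_eq0 i : (n < i)%N -> E i = 0.
Proof.
move=> ni; apply/matrixP => a b; rewrite !mxE.
case: eqP => [ki|_]; last by rewrite mxE.
by move: (ltn_ord (tagnat.sig1 a)); rewrite ki ltnS leqNgt ni.
Qed.

Lemma adj_blockcol_shift i : (E i) ^t* *m S = (E i.+1) ^t*.
Proof.
rewrite /blockshift mulmx_sumr.
under [LHS]eq_bigr do rewrite mulmxA mul_adj_blockcol.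
have [lin|nin] := ltnP i n.
  rewrite [LHS](bigD1 (Ordinal lin)) //= eqxx (leqW lin) mul1mx.
  rewrite [X in _ + X]big1 ?addr0 // => l.
  by rewrite -val_eqE eq_sym /= => /negPf ->; rewrite mul0mx.
rewrite [LHS]big1 => [|l _]; last first.
  have [il|_] := eqVneq i l; last by rewrite mul0mx.
  by move: (ltn_ord l); rewrite -il ltnNge nin.
by rewrite blockcol_eq0 ?ltnS // trmx0 map_mx0.
Qed.

Lemma blockshift_blockcolS i : (i < n)%N -> S *m E i.+1 = E i.
Proof.
move=> lin; rewrite /blockshift mulmx_suml.
under [LHS]eq_bigr do rewrite -mulmxA mul_adj_blockcol.
rewrite [LHS](bigD1 (Ordinal lin)) //= eqxx ltnS lin mulmx1.
rewrite [X in _ + X]big1 ?addr0 // => l.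
by rewrite -val_eqE eqSS /= => /negPf ->; rewrite mulmx0.
Qed.

Lemma sum_blockcolS_adj :
  \sum_(l < n) E l.+1 *m (E l.+1) ^t* = 1%:M - E 0 *m (E 0) ^t*.
Proof.
by rewrite -sum_blockcol_adj [X in _ = X - _]big_ord_recl addrAC subrr add0r.
Qed.

(** The defining property of Toeplitz matrices: shifting all indices by one
    does not change the entries.  The projector removes the first block row and
    column, which have no preimage under the shift. *)
Lemma toeplitz_shift (h : int -> 'M[C]_p) (Q := 1%:M - E 0 *m (E 0) ^t*)
    (G := \mxblock_(k < n.+1, l < n.+1) h (k%:Z - l%:Z) : 'M[C]_m) :
  S ^t* *m G *m S = Q *m G *m Q.
Proof.
rewrite /Q -sum_blockcolS_adj; apply: sum_adj_congr => k l.
have [kn ln] := (ltn_ord k, ltn_ord l).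
rewrite /G (adj_blockcol_toeplitz h (leqW kn) (leqW ln)).
have e2 : (E k.+1) ^t* *m (\mxblock_(k < n.+1, l < n.+1) h (k%:Z - l%:Z))
    *m E l.+1 = h (k.+1%:Z - l.+1%:Z) by exact: adj_blockcol_toeplitz.
rewrite e2.
by rewrite !intS opprD addrACA subrr add0r.
Qed.

End BlockCoordinates.

(** * The companion matrix and its resolvent on the unit circle *)

Section Companion.
Variables (C : numClosedFieldType) (m p : nat).
Variables (G S : 'M[C]_m) (e : 'M[C]_(m, p)).
Hypothesis G_posdef : posdefmx G.
Hypothesis adj_e_e : e ^t* *m e = 1%:M.
Let Q := 1%:M - e *m e ^t*.
Hypothesis shift_G : S ^t* *m G *m S = Q *m G *m Q.

Definition inv_corner : 'M[C]_p := e ^t* *m invmx G *m e.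

(** The [G]-orthogonal projection onto the kernel of [e^*]. *)
Definition gproj : 'M[C]_m :=
  1%:M - invmx G *m e *m invmx inv_corner *m e ^t*.

(** For the block shift [S], the companion matrix of the matrix polynomial
    [F(l) G^-1 e g^-1].  On block vectors seen as polynomials in [l], it projects
    onto the multiples of [l], orthogonally for [G], and divides by [l]. *)
Definition companion : 'M[C]_m := S *m gproj.

Local Notation g := inv_corner.
Local Notation B := companion.

Lemma adj_G : G ^t* = G.
Proof. by case: G_posdef => /hermsymmxP. Qed.

Lemma unit_G : G \in unitmx.
Proof. exact: posdefmx_unit. Qed.

Lemma inv_corner_posdef : posdefmx g.
Proof.
apply: posdefmx_conj (posdefmx_inv G_posdef) => v ev0.
by rewrite -[v]mul1mx -adj_e_e -mulmxA ev0 mulmx0.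
Qed.

Lemma unit_g : g \in unitmx.
Proof. exact/posdefmx_unit/inv_corner_posdef. Qed.

Lemma adj_g : g ^t* = g.
Proof. by case: inv_corner_posdef => /hermsymmxP. Qed.

Lemma adj_invg : (invmx g) ^t* = invmx g.
Proof. by rewrite adjmx_inv adj_g. Qed.

Lemma adj_e_gproj : e ^t* *m gproj = 0.
Proof.
by rewrite /gproj mulmxBr mulmx1 !mulmxA -/g mulmxV ?unit_g // mul1mx subrr.
Qed.

Lemma mul_G_gproj : G *m gproj = G - e *m invmx g *m e ^t*.
Proof. by rewrite /gproj mulmxBr mulmx1 !mulmxA mulmxV ?unit_G // mul1mx. Qed.

Lemma mul_adj_gproj_G : gproj ^t* *m G = G *m gproj.
Proof.
rewrite mul_G_gproj /gproj adjmxB adjmx1 mulmxBl mul1mx; congr (_ - _).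
rewrite !adjmxM trmxCK !adjmx_inv adj_G adj_g -!mulmxA mulVmx ?unit_G //.
by rewrite mulmx1.
Qed.

Lemma mul_Q_gproj : Q *m gproj = gproj.
Proof.
rewrite /Q mulmxBl mul1mx -mulmxA [_ *m gproj in X in _ - X]adj_e_gproj.
by rewrite mulmx0 subr0.
Qed.

Lemma gproj_idem : gproj *m gproj = gproj.
Proof.
rewrite {1}/gproj mulmxBl mul1mx -!mulmxA [e ^t* *m _]adj_e_gproj.
by rewrite !mulmx0 subr0.
Qed.

(** [B^* G B = Pi^* (S^* G S) Pi = Pi^* G Pi = G Pi], as [S] is isometric on the
    range of the self-adjoint projection [Pi]; and [G Pi] is [G] minus its Schur
    correction in the first block. *)
Lemma companion_stein : G - B ^t* *m G *m B = e *m invmx g *m e ^t*.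
Proof.
have -> : B ^t* *m G *m B = gproj ^t* *m (S ^t* *m G *m S) *m gproj.
  by rewrite adjmxM !mulmxA.
have adjQ : Q ^t* = Q by rewrite adjmxB adjmx1 adjmxM trmxCK.
rewrite shift_G -{1}adjQ -mul_Q_gproj adjmxM.
have -> : gproj ^t* *m Q ^t* *m (Q ^t* *m G *m Q) *m (Q *m gproj)
          = gproj ^t* *m G *m gproj.
  have q2 : Q *m (Q *m gproj) = gproj by rewrite !mul_Q_gproj.
  have q3 : gproj ^t* *m Q ^t* *m Q ^t* = gproj ^t* by rewrite -2!adjmxM q2.
  by rewrite mulmxA mulmxA q3 -mulmxA q2.
by rewrite mul_adj_gproj_G -mulmxA gproj_idem mul_G_gproj opprB addrC subrK.
Qed.

(** Applied to block coordinate vectors [X = e_i] and [X' = e_(i+1)], this says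
    that [B] moves each block row of [G] to the next one. *)
Lemma companion_shift k (X X' : 'M[C]_(m, k)) :
  S *m X' = X -> e ^t* *m X' = 0 -> X ^t* *m G *m B = X' ^t* *m G.
Proof.
move=> SX eX; have QX : Q *m X' = X'.
  by rewrite /Q mulmxBl mul1mx -mulmxA eX mulmx0 subr0.
have adjQ : Q ^t* = Q by rewrite adjmxB adjmx1 adjmxM trmxCK.
have adjX : X' ^t* *m Q = X' ^t* by rewrite -{1}adjQ -adjmxM QX.
have -> : X ^t* *m G *m B = X' ^t* *m (S ^t* *m G *m S) *m gproj.
  by rewrite -SX adjmxM /B !mulmxA.
rewrite shift_G !mulmxA adjX -mulmxA mul_Q_gproj -mulmxA mul_G_gproj mulmxBr.
have adjeX : X' ^t* *m e = 0 by rewrite -[e]trmxCK -adjmxM eX trmx0 map_mx0.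
by rewrite !mulmxA adjeX !mul0mx subr0.
Qed.

Section UnitCircle.
Variable l : C.
Hypothesis l_circle : `|l| = 1.

Lemma mul_conj_circle : l^* * l = 1.
Proof. by rewrite mulrC -normCK l_circle expr1n. Qed.

(** If [v = l B v] with [|l| = 1], then [v] and [B v] have the same energy, so
    the Stein equation forces the first block of [v] to vanish; then [B] acts on
    [v] as the shift, and the hypothesis on [S] applies. *)
Lemma companion_resolvent_unit :
  (forall v : 'cV[C]_m, e ^t* *m v = 0 -> v = l *: (S *m v) -> v = 0) ->
  1%:M - l *: B \in unitmx.
Proof.
move=> Sinj; apply: mulmx_inj0_unit => v /eqP.
rewrite mulmxBl mul1mx subr_eq0 -scalemxAl => /eqP vB.
have qv : v ^t* *m G *m v = v ^t* *m (B ^t* *m G *m B) *m v.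
  rewrite {1 2}vB adjmxZ -!scalemxAl -scalemxAr scalerA mul_conj_circle.
  by rewrite scale1r adjmxM !mulmxA.
have ev0 : e ^t* *m v = 0.
  apply: (posdefmx_eq0 (posdefmx_inv inv_corner_posdef)).
  have -> : (e ^t* *m v) ^t* *m invmx g *m (e ^t* *m v)
            = v ^t* *m (G - B ^t* *m G *m B) *m v.
    by rewrite companion_stein adjmxM trmxCK !mulmxA.
  by rewrite mulmxBr mulmxBl -qv subrr mxE.
apply: Sinj => //; rewrite {1}vB /companion -(mulmxA S) /gproj mulmxBl mul1mx.
by rewrite -!mulmxA [e ^t* *m _]ev0 !mulmx0 subr0.
Qed.

Section Resolvent.
Variable R : 'M[C]_m.
Hypothesis mulR : (1%:M - l *: B) *m R = 1%:M.

(** Expanding [(1 - M)^* G (1 - M)] with [M = 1 - l B] turns the Stein equation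
    into [M^* G + G M - M^* G M = e g^-1 e^*]; multiply by [R^*] and [R]. *)
Lemma resolvent_stein :
  G *m R + R ^t* *m G - G = R ^t* *m (e *m invmx g *m e ^t*) *m R.
Proof.
pose M := 1%:M - l *: B; have MR : M *m R = 1%:M := mulR.
have RM : R ^t* *m M ^t* = 1%:M by rewrite -adjmxM MR adjmx1.
have -> : e *m invmx g *m e ^t* = M ^t* *m G + G *m M - M ^t* *m G *m M.
  rewrite -companion_stein; have -> : M ^t* = 1%:M - l^* *: B ^t*.
    by rewrite adjmxB adjmx1 adjmxZ.
  have -> : B ^t* *m G *m B = (l^* *: B ^t*) *m G *m (l *: B).
    by rewrite -!scalemxAl -scalemxAr scalerA mul_conj_circle scale1r.
  rewrite /M; move: (l *: B) (l^* *: B ^t*) => X Y.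
  rewrite !(mulmxBr, mulmxBl, mul1mx, mulmx1).
  by rewrite opprB [RHS]addrC [RHS]addrA subrK [RHS]addrC [RHS]addrA subrK.
rewrite mulmxBr mulmxBl mulmxDr mulmxDl !mulmxA RM mul1mx.
by rewrite -!mulmxA MR !mulmx1.
Qed.

(** As [e^* Pi = 0], the hypothesis on [F S] gives [l F B = F Pi], that is
    [F (1 - l B) = F G^-1 e g^-1 e^*]. *)
Lemma resolvent_corner (F : 'M[C]_(p, m)) :
  F *m e = 1%:M -> l *: (F *m S) = F - e ^t* ->
  (F *m invmx G *m e *m invmx g) *m (e ^t* *m R *m e) = 1%:M.
Proof.
move=> Fe FS; rewrite -[RHS]Fe; pose M := 1%:M - l *: B.
have MR : M *m R = 1%:M := mulR.
have -> : F *m e = F *m M *m R *m e by rewrite -(mulmxA F) MR mulmx1.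
have -> : F *m M = F *m invmx G *m e *m invmx g *m e ^t*.
  rewrite /M mulmxBr mulmx1 -scalemxAr /B mulmxA scalemxAl FS mulmxBl.
  rewrite [e ^t* *m _]adj_e_gproj subr0 /gproj mulmxBr mulmx1 opprB addrC subrK.
  by rewrite !mulmxA.
by rewrite !mulmxA.
Qed.

(** The link with the density: [E E^* = P g^-1 P^*] for [P = F G^-1 e], and
    [X = e^* R e] inverts [P g^-1], so [X^* g^-1 X] inverts [E E^*]. *)
Lemma corner_spectral_density (F : 'M[C]_(p, m))
    (E := F *m (invmx G *m e *m invsqrtmx g)) :
  F *m e = 1%:M -> l *: (F *m S) = F - e ^t* ->
  E *m E ^t* \in unitmx /\
  invmx (E *m E ^t*) = e ^t* *m (G *m R + R ^t* *m G - G) *m e.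
Proof.
move=> Fe FS; set X := e ^t* *m R *m e; set P := F *m invmx G *m e.
have PX : P *m invmx g *m X = 1%:M by exact: resolvent_corner.
have [[/hermsymmxP hs _] ss] := invsqrtmxP inv_corner_posdef.
have EE : E *m E ^t* = P *m invmx g *m P ^t*.
  have -> : E = P *m invsqrtmx g by rewrite /E /P !mulmxA.
  by rewrite adjmxM hs -ss !mulmxA.
have adjgP : invmx g *m P ^t* *m X ^t* = 1%:M.
  apply: mulmx1C; rewrite -[RHS]adjmx1 -PX.
  by rewrite (adjmxM (P *m _)) (adjmxM P) adj_invg.
have inv : E *m E ^t* *m (X ^t* *m invmx g *m X) = 1%:M.
  have -> : E *m E ^t* *m (X ^t* *m invmx g *m X)
            = P *m (invmx g *m P ^t* *m X ^t*) *m (invmx g *m X).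
    by rewrite EE !mulmxA.
  by rewrite adjgP mulmx1 mulmxA.
have [uE _] := mulmx1_unit inv; split=> //.
rewrite -[LHS]mulmx1 -inv mulKmx // resolvent_stein.
by rewrite /X !adjmxM trmxCK !mulmxA.
Qed.

End Resolvent.
End UnitCircle.
End Companion.

(** * Limits of complex and matrix valued functions *)

Section ComplexLimits.
Variable R : realType.
Local Notation C := R[i].

(** Stated on real and imaginary parts, the form in which the integrals of
    complex functions are defined. *)
Definition ccvg (T : Type) (F : set_system T) (f : T -> C) (l : C) : Prop :=
  (complex.Re (f x) @[x --> F] --> complex.Re l) /\
  (complex.Im (f x) @[x --> F] --> complex.Im l).

Definition mxcvg (T : Type) (F : set_system T) k q (f : T -> 'M[C]_(k, q))
    (L : 'M[C]_(k, q)) : Prop :=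
  forall i j, ccvg F (fun x => f x i j) (L i j).

Lemma conjCE (z : C) : z^*%R = (complex.Re z) -i* (complex.Im z).
Proof. by case: z. Qed.

Lemma ReD (x y : C) : complex.Re (x + y) = complex.Re x + complex.Re y.
Proof. by case: x y => [a b] [c d]. Qed.

Lemma ImD (x y : C) : complex.Im (x + y) = complex.Im x + complex.Im y.
Proof. by case: x y => [a b] [c d]. Qed.

Lemma ReM (x y : C) :
  complex.Re (x * y)
  = complex.Re x * complex.Re y - complex.Im x * complex.Im y.
Proof. by case: x y => [a b] [c d]. Qed.

Lemma ImM (x y : C) :
  complex.Im (x * y)
  = complex.Re x * complex.Im y + complex.Im x * complex.Re y.
Proof. by case: x y => [a b] [c d]. Qed.

Section Filter.
Context (T : Type) (F : set_system T) {FF : Filter F}.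

Lemma ccvg_cst (c : C) : ccvg F (fun=> c) c.
Proof. by split; apply: cvg_cst. Qed.

Lemma ccvgD f g (a b : C) :
  ccvg F f a -> ccvg F g b -> ccvg F (fun x => f x + g x) (a + b).
Proof.
move=> [fr fi] [gr gi]; split; rewrite ?ReD ?ImD.
  by under eq_fun do rewrite ReD; apply: cvgD.
by under eq_fun do rewrite ImD; apply: cvgD.
Qed.

Lemma ccvgM f g (a b : C) :
  ccvg F f a -> ccvg F g b -> ccvg F (fun x => f x * g x) (a * b).
Proof.
move=> [fr fi] [gr gi]; split; rewrite ?ReM ?ImM.
  by under eq_fun do rewrite ReM; apply: cvgB; apply: cvgM.
by under eq_fun do rewrite ImM; apply: cvgD; apply: cvgM.
Qed.

Lemma ccvg_conj f (a : C) : ccvg F f a -> ccvg F (fun x => (f x)^*%R) (a^*%R).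
Proof.
move=> [fr fi]; split; rewrite conjCE /=.
  by under eq_fun do rewrite conjCE /=.
by under eq_fun do rewrite conjCE /=; apply: cvgN.
Qed.

Lemma ccvgV f (a : C) : a != 0 -> ccvg F f a -> ccvg F (fun x => (f x)^-1) a^-1.
Proof.
move=> a0 [fr fi].
have VE (z : C) : z^-1 =
    (complex.Re z / (complex.Re z ^+ 2 + complex.Im z ^+ 2)) -i*
    (complex.Im z / (complex.Re z ^+ 2 + complex.Im z ^+ 2)) by case: z.
have nz : complex.Re a ^+ 2 + complex.Im a ^+ 2 != 0.
  rewrite paddr_eq0 ?sqr_ge0 // !sqrf_eq0.
  by move: a0; rewrite eq_complex.
have n2 : complex.Re (f x) ^+ 2 + complex.Im (f x) ^+ 2 @[x --> F] -->
  complex.Re a ^+ 2 + complex.Im a ^+ 2 by apply: cvgD; apply: cvgM.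
split; rewrite VE /=.
  by under eq_fun do rewrite VE /=; apply: cvgM => //; apply: cvgV.
under eq_fun do rewrite VE /=.
by apply: cvgN; apply: cvgM => //; apply: cvgV.
Qed.

Lemma ccvg_sum I (r : seq I) (P : pred I) (f : I -> T -> C) (a : I -> C) :
  (forall i, P i -> ccvg F (f i) (a i)) ->
  ccvg F (fun x => \sum_(i <- r | P i) f i x) (\sum_(i <- r | P i) a i).
Proof.
move=> fa; elim: r => [|i r IH].
  by rewrite big_nil; under eq_fun do rewrite big_nil; apply: ccvg_cst.
rewrite big_cons; under eq_fun do rewrite big_cons.
by case: ifP => // Pi; apply: ccvgD => //; apply: fa.
Qed.

Lemma ccvg_prod I (r : seq I) (P : pred I) (f : I -> T -> C) (a : I -> C) :
  (forall i, P i -> ccvg F (f i) (a i)) ->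
  ccvg F (fun x => \prod_(i <- r | P i) f i x) (\prod_(i <- r | P i) a i).
Proof.
move=> fa; elim: r => [|i r IH].
  by rewrite big_nil; under eq_fun do rewrite big_nil; apply: ccvg_cst.
rewrite big_cons; under eq_fun do rewrite big_cons.
by case: ifP => // Pi; apply: ccvgM => //; apply: fa.
Qed.

Lemma mxcvg_cst k q (A : 'M[C]_(k, q)) : mxcvg F (fun=> A) A.
Proof. by move=> i j; apply: ccvg_cst. Qed.

Lemma mxcvgD k q f g (A B : 'M[C]_(k, q)) :
  mxcvg F f A -> mxcvg F g B -> mxcvg F (fun x => f x + g x) (A + B).
Proof.
move=> fA gB i j; rewrite mxE; under eq_fun do rewrite mxE.
exact: ccvgD.
Qed.

Lemma mxcvgZ k q f g a (A : 'M[C]_(k, q)) :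
  ccvg F f a -> mxcvg F g A -> mxcvg F (fun x => f x *: g x) (a *: A).
Proof.
move=> fa gA i j; rewrite mxE; under eq_fun do rewrite mxE.
exact: ccvgM.
Qed.

Lemma mxcvgN k q f (A : 'M[C]_(k, q)) :
  mxcvg F f A -> mxcvg F (fun x => - f x) (- A).
Proof.
move=> fA; rewrite -scaleN1r; under eq_fun do rewrite -scaleN1r.
by apply: mxcvgZ => //; apply: ccvg_cst.
Qed.

Lemma mxcvgM k q s f g (A : 'M[C]_(k, q)) (B : 'M[C]_(q, s)) :
  mxcvg F f A -> mxcvg F g B -> mxcvg F (fun x => f x *m g x) (A *m B).
Proof.
move=> fA gB i j; rewrite mxE; under eq_fun do rewrite mxE.
by apply: ccvg_sum => r _; apply: ccvgM.
Qed.

Lemma mxcvg_adj k q f (A : 'M[C]_(k, q)) :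
  mxcvg F f A -> mxcvg F (fun x => (f x) ^t*) (A ^t*).
Proof.
move=> fA i j; rewrite !mxE; under eq_fun do rewrite !mxE.
exact: ccvg_conj.
Qed.

Lemma mxcvg_det k f (A : 'M[C]_k) :
  mxcvg F f A -> ccvg F (fun x => \det (f x)) (\det A).
Proof.
move=> fA; apply: ccvg_sum => s _; apply: ccvgM; first exact: ccvg_cst.
by apply: ccvg_prod => i _; apply: fA.
Qed.

Lemma mxcvg_inv k f (A : 'M[C]_k) :
  A \in unitmx -> (forall x, f x \in unitmx) ->
  mxcvg F f A -> mxcvg F (fun x => invmx (f x)) (invmx A).
Proof.
move=> uA uf fA; rewrite /invmx uA.
under eq_fun do rewrite uf.
apply: mxcvgZ.
  apply: ccvgV; last exact: mxcvg_det.
  by rewrite -unitfE -unitmxE.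
move=> i j; rewrite mxE; under eq_fun do rewrite mxE.
apply: ccvgM; first exact: ccvg_cst.
apply: mxcvg_det => a b; rewrite !mxE; under eq_fun do rewrite !mxE.
exact: fA.
Qed.

End Filter.

Definition ccont (f : R -> C) : Prop := forall t, ccvg (nbhs t) f (f t).

Definition mxcont k q (f : R -> 'M[C]_(k, q)) : Prop :=
  forall t, mxcvg (nbhs t) f (f t).

Lemma ccont_expi (a : R) : ccont (fun t => expi (a * t)).
Proof.
move=> t; split; rewrite /expi /=.
  apply: (@continuous_comp _ _ _ (fun t => a * t) cos).
    exact: mulrl_continuous.
  exact: continuous_cos.
apply: (@continuous_comp _ _ _ (fun t => a * t) sin).
  exact: mulrl_continuous.
exact: continuous_sin.
Qed.

Lemma mxcont_entry k q (f : R -> 'M[C]_(k, q)) i j :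
  mxcont f -> ccont (fun t => f t i j).
Proof. by move=> cf t; apply: cf. Qed.

End ComplexLimits.

(** * Integrals of complex functions *)

Section ComplexIntegral.
Variable R : realType.
Local Notation C := R[i].
Local Notation mu := (@lebesgue_measure R).

Definition cint (D : set R) (f : R -> C) : C :=
  (\int[mu]_(t in D) complex.Re (f t)) +i* (\int[mu]_(t in D) complex.Im (f t)).

Lemma ReB (x y : C) : complex.Re (x - y) = complex.Re x - complex.Re y.
Proof. by case: x y => [a b] [c d]. Qed.

Lemma ImB (x y : C) : complex.Im (x - y) = complex.Im x - complex.Im y.
Proof. by case: x y => [a b] [c d]. Qed.

Lemma Im_norm_le (z : C) : `|complex.Im z|%:C <= `|z|.
Proof. by rewrite normc_def lecR -sqrtr_sqr ler_wsqrtr // lerDr sqr_ge0. Qed.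

Lemma norm_le_ReIm (z : C) : `|z| <= (`|complex.Re z| + `|complex.Im z|)%:C.
Proof.
rewrite normc_def lecR -(ler_pXn2r (n := 2)) ?nnegrE ?sqrtr_ge0 ?addr_ge0 //.
rewrite sqr_sqrtr ?addr_ge0 ?sqr_ge0 // sqrrD !real_normK ?num_real //.
by rewrite lerD2r lerDl mulrn_wge0 ?mulr_ge0.
Qed.

Lemma continuous_integrable_itv (f : R -> R) (a b : R) :
  continuous f -> mu.-integrable `[a, b] (EFin \o f).
Proof.
move=> cf; apply: continuous_compact_integrable; first exact: segment_compact.
exact: continuous_subspaceT.
Qed.

Lemma continuous_Re (f : R -> C) : ccont f -> continuous (@complex.Re R \o f).
Proof. by move=> cf t; case: (cf t). Qed.

Lemma continuous_Im (f : R -> C) : ccont f -> continuous (@complex.Im R \o f).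
Proof. by move=> cf t; case: (cf t). Qed.

Lemma integrable_Re (f : R -> C) a b : ccont f ->
  mu.-integrable `[a, b] (EFin \o (@complex.Re R \o f)).
Proof. by move=> /continuous_Re; apply: continuous_integrable_itv. Qed.

Lemma integrable_Im (f : R -> C) a b : ccont f ->
  mu.-integrable `[a, b] (EFin \o (@complex.Im R \o f)).
Proof. by move=> /continuous_Im; apply: continuous_integrable_itv. Qed.

Lemma cintD f g a b : ccont f -> ccont g ->
  cint `[a, b] (fun t => f t + g t) = cint `[a, b] f + cint `[a, b] g.
Proof.
move=> cf cg; rewrite /cint.
under eq_Rintegral do rewrite ReD.
under [in X in _ +i* X]eq_Rintegral do rewrite ImD.
rewrite (RintegralD _ (integrable_Re a b cf) (integrable_Re a b cg)) //.
by rewrite (RintegralD _ (integrable_Im a b cf) (integrable_Im a b cg)).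
Qed.

Lemma cintZ f a b (c : C) : ccont f ->
  cint `[a, b] (fun t => c * f t) = c * cint `[a, b] f.
Proof.
move=> cf; have [fr fi] := (integrable_Re a b cf, integrable_Im a b cf).
have mcZ (r : R) (g : R -> R) : mu.-integrable `[a, b] (EFin \o g) ->
    mu.-integrable `[a, b] (EFin \o (fun t => r * g t)).
  move=> ig.
  rewrite [X in _.-integrable _ X](_ : _ = (fun t => r%:E * (EFin \o g) t)%E) //.
  exact: integrableZl.
rewrite /cint; under eq_Rintegral do rewrite ReM.
rewrite RintegralB //=;
  [|exact: (mcZ _ (@complex.Re R \o f))|exact: (mcZ _ (@complex.Im R \o f))].
rewrite !RintegralZl //.
under [in X in _ +i* X = _]eq_Rintegral do rewrite ImM.
rewrite RintegralD //=;
  [|exact: (mcZ _ (@complex.Im R \o f))|exact: (mcZ _ (@complex.Re R \o f))].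
rewrite !RintegralZl //.
by apply/eqP; rewrite eq_complex ReM ImM /= !eqxx.
Qed.

Lemma cint_conj f a b : ccont f ->
  cint `[a, b] (fun t => (f t)^*%R) = (cint `[a, b] f)^*%R.
Proof.
move=> cf; rewrite conjCE /cint /=; congr (_ +i* _).
  by apply: eq_Rintegral => t _; rewrite conjCE.
rewrite -mulN1r -(RintegralZl _ _ (integrable_Im a b cf)) //.
by apply: eq_Rintegral => t _; rewrite conjCE mulN1r.
Qed.

Lemma cint_sum I (r : seq I) (f : I -> R -> C) a b :
  (forall i, ccont (f i)) ->
  cint `[a, b] (fun t => \sum_(i <- r) f i t) = \sum_(i <- r) cint `[a, b] (f i).
Proof.
move=> cf; elim: r => [|i r IH].
  rewrite [RHS]big_nil -[RHS](mul0r (cint `[a, b] (fun=> 0))) -cintZ.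
    by congr (cint _ _); apply/funext => t; rewrite big_nil mul0r.
  by move=> t; apply: ccvg_cst.
rewrite big_cons -IH -cintD //; last by move=> t; apply: ccvg_sum => j _; apply: cf.
by congr (cint _ _); apply/funext => t; rewrite big_cons.
Qed.

Lemma cint_itvB f x y z : ccont f -> x <= y -> y <= z ->
  cint `[x, z] f - cint `[x, y] f = cint `[y, z] f.
Proof.
move=> cf xy yz; apply/eqP; rewrite eq_complex ReB ImB /=; apply/andP; split; apply/eqP.
  rewrite Rintegral_itvB ?bnd_simp //; last exact: (integrable_Re x z cf).
  rewrite Rintegral_itv_obnd_cbnd //.
  apply: integrableS (integrable_Re y z cf) => //.
  exact: subset_itv_oc_cc.
rewrite Rintegral_itvB ?bnd_simp //; last exact: (integrable_Im x z cf).
rewrite Rintegral_itv_obnd_cbnd //.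
apply: integrableS (integrable_Im y z cf) => //.
exact: subset_itv_oc_cc.
Qed.

Lemma Rintegral_norm_le (f : R -> R) a b (M : R) : a <= b -> continuous f ->
  (forall t, a <= t <= b -> `|f t| <= M) ->
  `|\int[mu]_(t in `[a, b]) f t| <= M * (b - a).
Proof.
move=> ab cf fM; have intf := continuous_integrable_itv a b cf.
apply: le_trans (le_normr_Rintegral _ intf) _ => //.
pose g := fun _ : R => M.
have cg : continuous g by move=> t; apply: cvg_cst.
have ig := continuous_integrable_itv a b cg.
have -> : M * (b - a) = \int[mu]_(t in `[a, b]) g t.
  rewrite Rintegral_cst //= lebesgue_measure_itv /= lte_fin.
  case: ltP => [//|ba]; have -> : b = a by apply/le_anti/andP.
  by rewrite subrr.
apply: le_Rintegral => //.
by apply: continuous_integrable_itv => t; apply: cvg_norm; apply: cf.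
Qed.

Lemma cint_norm_le (f : R -> C) a b (M : R) : a <= b -> ccont f ->
  (forall t, a <= t <= b -> `|f t| <= M%:C) ->
  `|cint `[a, b] f| <= (2 * M * (b - a))%:C.
Proof.
move=> ab cf fM; apply: le_trans (norm_le_ReIm _) _; rewrite lecR /=.
rewrite -mulrA mulr_natl mulr2n; apply: lerD.
  apply: (Rintegral_norm_le ab (continuous_Re cf)) => t /fM tM.
  by rewrite -lecR; apply: le_trans (normc_ge_Re _) tM.
apply: (Rintegral_norm_le ab (continuous_Im cf)) => t /fM tM.
by rewrite -lecR; apply: le_trans (Im_norm_le _) tM.
Qed.

Lemma ccont_bounded (f : R -> C) a b : a <= b -> ccont f ->
  exists2 M : R, 0 <= M & forall t, a <= t <= b -> `|f t| <= M%:C.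
Proof.
move=> ab cf; pose g t := `|complex.Re (f t)| + `|complex.Im (f t)|.
have cg : continuous g.
  by move=> t; have [fr fi] := cf t; apply: cvgD; apply: cvg_norm.
have [c _ gc] := EVT_max ab (continuous_subspaceT cg).
exists (g c) => [|t tab]; first by rewrite addr_ge0.
by apply: le_trans (norm_le_ReIm _) _; rewrite lecR; apply: gc; rewrite in_itv.
Qed.

Lemma cint_ge0 (f : R -> C) D : (forall t, 0 <= f t) -> 0 <= cint D f.
Proof.
move=> f0; rewrite lecE /= /cint; apply/andP; split; last first.
  by apply: Rintegral_ge0 => t _; have := f0 t; rewrite lecE => /andP[].
apply/eqP; under eq_Rintegral do rewrite ger0_Im //.
by rewrite /Rintegral integral0.
Qed.

Lemma Rintegral_FTC2 (f F : R -> R) a b : a < b -> continuous f ->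
  (forall x : R, is_derive x 1 F (f x)) -> \int[mu]_(t in `[a, b]) f t = F b - F a.
Proof.
move=> ab cf dF; rewrite /Rintegral.
have cF : continuous F.
  by move=> x; apply: differentiable_continuous; apply/derivable1_diffP; case: (dF x).
rewrite (@continuous_FTC2 _ f F) //.
- exact: continuous_subspaceT.
- split; first by move=> x _; case: (dF x).
    exact/cvg_at_right_filter/cF.
  exact/cvg_at_left_filter/cF.
- by move=> x _; rewrite derive1E; case: (dF x).
Qed.

Lemma expi_2pi (k : int) : expi (k%:~R * (2 * pi)) = 1 :> C.
Proof.
have p2 : 2 * pi = pi *+ 2 :> R by rewrite mulr_natl.
have pn (j : nat) : cos (j%:R * (2 * pi)) = 1 :> R /\ sin (j%:R * (2 * pi)) = 0 :> R.
  rewrite p2 mulr_natl -[X in cos X]add0r -[X in sin X]add0r.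
  by rewrite (periodicn (@cosD2pi R)) (periodicn (@sinD2pi R)) cos0 sin0.
rewrite /expi; case: k => j.
  by have [-> ->] := pn j.
by rewrite NegzE mulrNz mulNr cosN sinN; have [-> ->] := pn j.+1; rewrite oppr0.
Qed.

Lemma is_derive_scale (a x : R) : is_derive x 1 (fun t => a * t) a.
Proof.
have := is_deriveZ a (is_derive_id x (1 : R)).
by rewrite /GRing.scale /= mulr1.
Qed.

Lemma is_derive_sin_scale (a x : R) :
  is_derive x 1 (fun t => sin (a * t)) (a * cos (a * x)).
Proof.
have := @is_derive1_comp _ sin (fun t => a * t) x _ _
  (is_derive_sin (a * x)) (is_derive_scale a x).
by rewrite mulrC.
Qed.

Lemma is_derive_cos_scale (a x : R) :
  is_derive x 1 (fun t => cos (a * t)) (- (a * sin (a * x))).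
Proof.
have := @is_derive1_comp _ cos (fun t => a * t) x _ _
  (is_derive_cos (a * x)) (is_derive_scale a x).
by rewrite mulNr mulrC.
Qed.

Lemma cint_expi (k : int) : k != 0 ->
  cint `[0, 2 * pi] (fun t => expi (- (k%:~R * t))) = 0.
Proof.
move=> k0; pose a : R := (- k)%:~R.
have a0 : a != 0 by rewrite intr_eq0 oppr_eq0.
have -> : (fun t => expi (- (k%:~R * t))) = (fun t => expi (a * t)).
  by apply/funext => t; rewrite /a mulrNz mulNr.
have lt02 : 0 < 2 * pi :> R by rewrite mulr_gt0 ?pi_gt0.
have ce := ccont_expi a.
have [c1 s0] : cos (a * (2 * pi)) = 1 /\ sin (a * (2 * pi)) = 0.
  by have [-> ->] := expi_2pi (- k).
rewrite /cint; congr (_ +i* _).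
  have dS (x : R) : is_derive x 1 (fun t => a^-1 * sin (a * t)) (cos (a * x)).
    have := is_deriveZ a^-1 (is_derive_sin_scale a x).
    by rewrite /GRing.scale /= mulKf.
  rewrite (Rintegral_FTC2 lt02 (continuous_Re ce) dS).
  by rewrite s0 !mulr0 sin0 mulr0 subrr.
have dC (x : R) : is_derive x 1 (fun t => - a^-1 * cos (a * t)) (sin (a * x)).
  have := is_deriveZ (- a^-1) (is_derive_cos_scale a x).
  by rewrite /GRing.scale /= mulrNN mulKf.
rewrite (Rintegral_FTC2 lt02 (continuous_Im ce) dC).
by rewrite c1 !mulr0 cos0 subrr.
Qed.

Lemma cint_expi0 :
  cint `[0, 2 * pi] (fun t => expi (- (0%:~R * t))) = (2 * pi)%:C.
Proof.
have -> : (fun t => expi (- (0%:~R * t))) = (fun=> 1 : C).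
  by apply/funext => t; rewrite mul0r oppr0 /expi cos0 sin0.
have gt02 : 0 < 2 * pi :> R by rewrite mulr_gt0 ?pi_gt0.
rewrite /cint /= !Rintegral_cst //= lebesgue_measure_itv /= lte_fin gt02.
by rewrite mul0r mul1r oppr0 addr0.
Qed.

Lemma MVT_norm_le (f f' : R -> R) (M s t : R) :
  (forall x : R, is_derive x 1 f (f' x)) -> (forall x, `|f' x| <= M) ->
  `|f s - f t| <= M * `|s - t|.
Proof.
move=> df f'M; wlog ts : s t / t <= s => [th|].
  have [/th//|/ltW/th] := leP t s.
  by rewrite distrC [X in _ * X]distrC.
have cf : continuous f.
  by move=> x; apply: differentiable_continuous; apply/derivable1_diffP; case: (df x).
have [c _ ->] := MVT_segment ts (fun x _ => df x) (continuous_subspaceT cf).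
by rewrite normrM ler_wpM2r.
Qed.

Lemma expi_lipschitz (a s t : R) :
  `|expi (a * s) - expi (a * t)| <= (2 * `|a| * `|s - t|)%:C.
Proof.
apply: le_trans (norm_le_ReIm _) _; rewrite lecR /= -mulrA mulr_natl mulr2n.
apply: lerD.
  apply: (MVT_norm_le (f := fun x => cos (a * x)) s t (is_derive_cos_scale a)) => x.
  by rewrite normrN normrM ler_piMr // ler_norml sin_geN1 sin_le1.
apply: (MVT_norm_le (f := fun x => sin (a * x)) s t (is_derive_sin_scale a)) => x.
by rewrite normrM ler_piMr // ler_norml cos_geN1 cos_le1.
Qed.

End ComplexIntegral.

(** * Integrals of matrix functions *)

Section MatrixIntegral.
Variable R : realType.
Local Notation C := R[i].
Local Notation mu := (@lebesgue_measure R).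

Lemma mx_integralE q (D : set R) (f : R -> 'M[C]_q) i j :
  mx_integral D f i j = cint D (fun t => f t i j).
Proof. by rewrite mxE. Qed.

Lemma mxcont_integrable q (f : R -> 'M[C]_q) a b :
  mxcont f -> mx_integrable `[a, b] f.
Proof.
move=> cf i j; split.
  exact: (integrable_Re a b (mxcont_entry i j cf)).
exact: (integrable_Im a b (mxcont_entry i j cf)).
Qed.

Lemma mx_integralD q (f g : R -> 'M[C]_q) a b : mxcont f -> mxcont g ->
  mx_integral `[a, b] (fun t => f t + g t)
  = mx_integral `[a, b] f + mx_integral `[a, b] g.
Proof.
move=> cf cg; apply/matrixP => i j.
rewrite [RHS]mxE !mx_integralE -cintD; try exact: mxcont_entry.
by congr cint; apply/funext => t; rewrite mxE.
Qed.

Lemma mx_integral_mul k q (A : 'M[C]_(k, q)) (B : 'M[C]_(q, k))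
    (f : R -> 'M[C]_q) a b : mxcont f ->
  mx_integral `[a, b] (fun t => A *m f t *m B)
  = A *m mx_integral `[a, b] f *m B.
Proof.
move=> cf; apply/matrixP => i j; rewrite mx_integralE.
have mulE (X : 'M[C]_q) : (A *m X *m B) i j
    = \sum_r \sum_s A i s * B r j * X s r.
  rewrite mxE; apply: eq_bigr => r _; rewrite mxE mulr_suml.
  by apply: eq_bigr => s _; rewrite mulrAC.
have -> : (fun t => (A *m f t *m B) i j)
    = (fun t => \sum_r \sum_s A i s * B r j * f t s r) by apply/funext => t.
rewrite mulE.
rewrite cint_sum => [|r].
  apply: eq_bigr => r _; rewrite cint_sum => [|s].
    by apply: eq_bigr => s _; rewrite cintZ ?mx_integralE //; exact: mxcont_entry.
  by move=> t; apply: ccvgM; [exact: ccvg_cst|exact: cf].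
move=> t; apply: ccvg_sum => s _.
by apply: ccvgM; [exact: ccvg_cst|exact: cf].
Qed.

Lemma mx_integral_adj q (f : R -> 'M[C]_q) a b : mxcont f ->
  mx_integral `[a, b] (fun t => (f t) ^t*) = (mx_integral `[a, b] f) ^t*.
Proof.
move=> cf; apply/matrixP => i j.
rewrite [RHS]mxE [X in _ = X^*%R]mxE !mx_integralE -cint_conj.
  by congr cint; apply/funext => t; rewrite !mxE.
exact: mxcont_entry.
Qed.

Lemma mx_integralZr q (f : R -> C) (A : 'M[C]_q) a b : ccont f ->
  mx_integral `[a, b] (fun t => f t *: A) = cint `[a, b] f *: A.
Proof.
move=> cf; apply/matrixP => i j; rewrite mx_integralE mxE mulrC -cintZ //.
by congr cint; apply/funext => t; rewrite mxE mulrC.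
Qed.

Lemma mxcont_bounded k q (f : R -> 'M[C]_(k, q)) a b : a <= b -> mxcont f ->
  exists2 M : R, 0 <= M &
    forall t i j, a <= t <= b -> `|f t i j| <= M%:C.
Proof.
move=> ab cf.
have Mf (ij : 'I_k * 'I_q) : exists M : R,
    0 <= M /\ forall t, a <= t <= b -> `|f t ij.1 ij.2| <= M%:C.
  by have [M M0 fM] := ccont_bounded ab (mxcont_entry ij.1 ij.2 cf); exists M.
have [M MP] := fin_all_exists Mf.
exists (\sum_ij M ij) => [|t i j tab].
  by apply: sumr_ge0 => ij _; have [] := MP ij.
have [_ /(_ t tab) /=] := MP (i, j).
move=> /le_trans; apply; rewrite lecR (bigD1 (i, j)) //= lerDl.
by apply: sumr_ge0 => ij _; have [] := MP ij.
Qed.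

End MatrixIntegral.

(** * Bounded backward orbits of the companion matrix *)

Section BackwardOrbit.
Variable R : realType.
Local Notation C := R[i].

Lemma mxcvg_shiftS k q (f : nat -> 'M[C]_(k, q)) L :
  mxcvg \oo (fun j => f j.+1) L <-> mxcvg \oo f L.
Proof.
have re a b := cvg_shiftS (fun j => complex.Re (f j a b)).
have im a b := cvg_shiftS (fun j => complex.Im (f j a b)).
by split=> fL a b; have [fr fi] := fL a b; split;
  [rewrite -re|rewrite -im|rewrite re|rewrite im].
Qed.

Lemma mxcvg_sum (T : Type) (F : set_system T) {FF : Filter F} k q N
    (f : 'I_N -> T -> 'M[C]_(k, q)) (L : 'I_N -> 'M[C]_(k, q)) :
  (forall i, mxcvg F (f i) (L i)) ->
  mxcvg F (fun x => \sum_i f i x) (\sum_i L i).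
Proof.
move=> fL a b; rewrite summxE; under eq_fun do rewrite summxE.
by apply: ccvg_sum => i _; apply: fL.
Qed.

Lemma ccvg0_sqr_le (f : nat -> C) (u : nat -> R) :
  u @ \oo --> 0 -> (forall k, `|f k| ^+ 2 <= (u k)%:C) -> ccvg \oo f 0.
Proof.
move=> u0 fu.
have s0 : Num.sqrt (u k) @[k --> \oo] --> 0.
  rewrite -[X in _ --> X]sqrtr0.
  by apply: (cvg_comp u Num.sqrt u0); exact: sqrt_continuous.
have fle k : `|complex.Re (f k)| <= Num.sqrt (u k) /\
             `|complex.Im (f k)| <= Num.sqrt (u k).
  have := fu k; rewrite -add_Re2_Im2 lecR => ruk.
  rewrite -!sqrtr_sqr; split; apply: ler_wsqrtr; apply: le_trans ruk.
    by rewrite lerDl sqr_ge0.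
  by rewrite lerDr sqr_ge0.
have sq (g : nat -> R) : (forall k, `|g k| <= Num.sqrt (u k)) -> g @ \oo --> 0.
  move=> gs; apply: norm_cvg0.
  apply: squeeze_cvgr (cvg_cst (0 : R)) s0.
  by apply: nearW => k; rewrite normr_ge0 gs.
by split; apply: sq => k; have [] := fle k.
Qed.

Variables (p n : nat).
Local Notation m := (\sum_(i < n.+1) p)%N.
Local Notation E := (blockcol C p n).
Local Notation S := (blockshift C p n).
Variable G : 'M[C]_m.
Hypothesis G_posdef : posdefmx G.
Hypothesis shift_G :
  S ^t* *m G *m S = (1%:M - E 0 *m (E 0) ^t*) *m G *m (1%:M - E 0 *m (E 0) ^t*).
Local Notation B := (companion G S (E 0)).
Local Notation g := (inv_corner G (E 0)).

Lemma adj_blockcol0_blockcol0 : (E 0) ^t* *m E 0 = 1%:M.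
Proof. by rewrite mul_adj_blockcol. Qed.
Local Notation EE := adj_blockcol0_blockcol0.

(** The Stein equation with [g^-1] written as the square of its hermitian root:
    one application of [B] loses exactly the size of the first block. *)
Lemma companion_energy (x : 'cV[C]_m) :
  (x ^t* *m G *m x) 0 0 - ((B *m x) ^t* *m G *m (B *m x)) 0 0
  = \sum_i `|(invsqrtmx g *m ((E 0) ^t* *m x)) i 0| ^+ 2.
Proof.
have [[/hermsymmxP hs _] ss] := invsqrtmxP (inv_corner_posdef G_posdef EE).
rewrite -quad_sqr hs ss.
have -> : ((E 0) ^t* *m x) ^t* *m invmx g *m ((E 0) ^t* *m x)
   = x ^t* *m (G - B ^t* *m G *m B) *m x.
  by rewrite (companion_stein G_posdef EE shift_G) adjmxM trmxCK !mulmxA.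
by rewrite mulmxBr mulmxBl adjmxM !mulmxA [in RHS]mxE [X in _ = _ + X]mxE.
Qed.

Lemma quad_norm_le (x : 'cV[C]_m) (M : R) : (forall i, `|x i 0| <= M%:C) ->
  `|(x ^t* *m G *m x) 0 0| <= \sum_i \sum_j M%:C * `|G j i| * M%:C.
Proof.
move=> xM; rewrite mxE; apply: le_trans (ler_norm_sum _ _ _) _.
apply: ler_sum => i _; rewrite mxE mulr_suml.
apply: le_trans (ler_norm_sum _ _ _) _; apply: ler_sum => j _.
rewrite !normrM !mxE norm_conjC.
by rewrite !ler_pM ?mulr_ge0.
Qed.

(** The energy [x^* G x] does not decrease along the orbit and is bounded, so
    its increments tend to 0; they control the first block of [x], and the shift
    structure of [B] propagates the convergence to 0 to all the blocks.  So the
    energy tends to 0, and being nondecreasing and nonnegative it is 0. *)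
Lemma bounded_backward_orbit_eq0 (x : nat -> 'cV[C]_m) (M : R) :
  (forall k, x k = B *m x k.+1) -> (forall k i, `|x k i 0| <= M%:C) ->
  x 0 = 0.
Proof.
move=> xB xM; pose a k := ((x k) ^t* *m G *m x k) 0 0.
pose d k := a k.+1 - a k.
have dE k : d k = \sum_i `|(invsqrtmx g *m ((E 0) ^t* *m x k.+1)) i 0| ^+ 2.
  by rewrite -companion_energy /d /a -xB.
have d_ge0 k : 0 <= d k by rewrite dE; apply: sumr_ge0 => i _; rewrite exprn_ge0.
have a_ge0 k : 0 <= a k by apply: posdefmx_ge0.
have reE (z : C) : 0 <= z -> z = (complex.Re z)%:C.
  by move=> z0; rewrite RRe_real // ger0_real.
pose u k := complex.Re (a k).
have u_nd : nondecreasing_seq u.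
  apply/nondecreasing_seqP => k; have := d_ge0 k; rewrite /d subr_ge0 lecE.
  by case/andP.
have u_cvg : cvgn u.
  apply: nondecreasing_is_cvgn => //.
  pose K : C := \sum_i \sum_j M%:C * `|G j i| * M%:C.
  exists (complex.Re K) => _ [k _ <-].
  have := quad_norm_le (xM k); rewrite ger0_norm; last exact: a_ge0.
  by rewrite lecE => /andP[].
have d_cvg : complex.Re (d k) @[k --> \oo] --> 0.
  rewrite -(subrr (limn u)).
  under eq_fun do rewrite ReB.
  by apply: cvgB; [rewrite (cvg_shiftS u); exact: u_cvg|exact: u_cvg].
have E0x : mxcvg \oo (fun k => (E 0) ^t* *m x k) 0.
  apply/mxcvg_shiftS.
  have sx0 : mxcvg \oo (fun k => invsqrtmx g *m ((E 0) ^t* *m x k.+1)) 0.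
    move=> i j; rewrite mxE ord1; apply: ccvg0_sqr_le d_cvg _ => k.
    rewrite -reE // dE (bigD1 i) //= lerDl.
    by apply: sumr_ge0 => r _; rewrite exprn_ge0.
  have us : invsqrtmx g \in unitmx.
    by apply: posdefmx_unit; have [] := invsqrtmxP (inv_corner_posdef G_posdef EE).
  rewrite -(mulmx0 _ (invmx (invsqrtmx g))).
  under eq_fun do rewrite -[_ *m x _](mulKmx us).
  by apply: mxcvgM => //; apply: mxcvg_cst.
have Eix i : mxcvg \oo (fun k => (E i) ^t* *m x k) 0.
  elim: i => [//|i IH]; apply/mxcvg_shiftS.
  have -> : (fun k => (E i.+1) ^t* *m x k.+1) = (fun k => (E i) ^t* *m x k +
      ((E i.+1) ^t* *m invmx G *m E 0 *m invmx g) *m ((E 0) ^t* *m x k.+1)).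
    apply/funext => k.
    have -> : (E i) ^t* *m x k = (E i.+1) ^t* *m gproj G (E 0) *m x k.+1.
      by rewrite xB /companion !mulmxA (adj_blockcol_shift R[i] p n i).
    rewrite /gproj mulmxBr mulmx1 mulmxBl !mulmxA.
    by rewrite subrK.
  rewrite -[X in mxcvg _ _ X]addr0; apply: mxcvgD => //.
  rewrite -(mulmx0 _ ((E i.+1) ^t* *m invmx G *m E 0 *m invmx g)).
  apply: mxcvgM; first exact: mxcvg_cst.
  exact: (iffRL (mxcvg_shiftS (fun k => (E 0) ^t* *m x k) 0) E0x).
have x0 : mxcvg \oo x 0.
  have -> : x = fun k => \sum_(i < n.+1) E i *m ((E i) ^t* *m x k).
    apply/funext => k; rewrite -[LHS]mul1mx -sum_blockcol_adj mulmx_suml.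
    by apply: eq_bigr => i _; rewrite mulmxA.
  rewrite -[X in mxcvg _ _ X](_ : \sum_(i < n.+1) E i *m 0 = _).
    by apply: mxcvg_sum => i; apply: mxcvgM; [exact: mxcvg_cst|exact: Eix].
  by apply: big1 => i _; rewrite mulmx0.
have u0 : u @ \oo --> 0.
  have ax : mxcvg \oo (fun k => (x k) ^t* *m G *m x k) (0 ^t* *m G *m 0).
    apply: mxcvgM => //; apply: mxcvgM; last exact: mxcvg_cst.
    exact: mxcvg_adj.
  by have [] := ax 0 0; rewrite mulmx0 mxE.
apply: (posdefmx_eq0 G_posdef); rewrite -/(a 0) (reE _ (a_ge0 0)).
suff -> : complex.Re (a 0) = 0 by [].
apply/le_anti/andP; split; last by have := a_ge0 0; rewrite lecE => /andP[].
by have := nondecreasing_cvgn_le u_nd u_cvg 0; rewrite (cvg_lim _ u0).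
Qed.

End BackwardOrbit.

(** * Fourier coefficients of the resolvent and of the density *)

Section ToeplitzResolvent.
Variables (R : realType) (p n : nat) (h : int -> 'M[R[i]]_p).
Local Notation C := R[i].
Local Notation m := (\sum_(i < n.+1) p)%N.
Local Notation E := (blockcol C p n).
Local Notation S := (blockshift C p n).
Local Notation G := (block_toeplitz n h).
Hypothesis G_posdef : posdefmx G.
Local Notation B := (companion G S (E 0)).
Local Notation Q := (1%:M - E 0 *m (E 0) ^t*).

Lemma norm_expi (t : R) : `|expi t| = 1 :> C.
Proof. by rewrite normc_def /= cos2Dsin2 sqrtr1. Qed.

Lemma expiD (s t : R) : expi (s + t) = expi s * expi t :> C.
Proof.
apply/eqP; rewrite eq_complex ReM ImM /= cosD sinD eqxx /=.
by rewrite addrC.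
Qed.

Lemma conj_expi (t : R) : (expi t)^*%R = expi (- t) :> C.
Proof. by rewrite conjCE /expi cosN sinN. Qed.

Lemma shift_block_toeplitz : S ^t* *m G *m S = Q *m G *m Q.
Proof. exact: toeplitz_shift. Qed.
Local Notation shift_G := shift_block_toeplitz.

Lemma Fmx_blockcol (l : C) (i : 'I_n.+1) : Fmx p n l *m E i = (l ^+ i)%:M.
Proof. by rewrite /Fmx mxrow_blockcol. Qed.

Lemma Fmx_blockcol0 (l : C) : Fmx p n l *m E 0 = 1%:M.
Proof. by have := Fmx_blockcol l ord0; rewrite expr0. Qed.

Lemma Fmx_shift (l : C) : l *: (Fmx p n l *m S) = Fmx p n l - (E 0) ^t*.
Proof.
have -> : Fmx p n l = \sum_(i < n.+1) l ^+ i *: (E i) ^t*.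
  rewrite -[LHS]mulmx1 -sum_blockcol_adj mulmx_sumr; apply: eq_bigr => i _.
  by rewrite mulmxA Fmx_blockcol mul_scalar_mx.
rewrite mulmx_suml scaler_sumr [X in _ = X - _]big_ord_recl expr0 scale1r.
rewrite addrAC subrr add0r [LHS]big_ord_recr /=.
rewrite -scalemxAl adj_blockcol_shift (blockcol_eq0 _ _ (ltnSn n)).
rewrite trmx0 map_mx0 !scaler0 addr0; apply: eq_bigr => i _.
by rewrite -scalemxAl adj_blockcol_shift scalerA -exprS.
Qed.

Lemma resolvent_unit (t : R) : 1%:M - expi t *: B \in unitmx.
Proof.
apply: (companion_resolvent_unit G_posdef (@adj_blockcol0_blockcol0 R p n)
          shift_G (norm_expi t)) => v v0 vS.
apply: blockcol_ext => i _; elim: i => [//|i IH].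
move: IH; rewrite {1}vS -scalemxAr mulmxA adj_blockcol_shift => /eqP.
rewrite scaler_eq0 -normr_eq0 norm_expi oner_eq0 /= => /eqP iv.
exact: iv.
Qed.

Definition resolvent (t : R) : 'M[C]_m := invmx (1%:M - expi t *: B).

Lemma mxcont_resolvent : mxcont resolvent.
Proof.
move=> t; apply: mxcvg_inv; [exact: resolvent_unit|exact: resolvent_unit|].
apply: mxcvgD; first exact: mxcvg_cst.
apply: mxcvgN; apply: mxcvgZ; last exact: mxcvg_cst.
have := @ccont_expi R 1 t; rewrite mul1r.
by under eq_fun do rewrite mul1r.
Qed.

Lemma resolventE (t : R) :
  resolvent t = 1%:M + B *m (expi t *: resolvent t).
Proof.
have := mulmxV (resolvent_unit t); rewrite -/(resolvent t).
rewrite mulmxBl mul1mx => /eqP; rewrite subr_eq => /eqP {1}->.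
by rewrite -scalemxAl -scalemxAr.
Qed.

Definition resolvent_fourier (k : int) : 'M[C]_m :=
  mx_integral `[0, 2 * pi] (fun t => expi (- (k%:~R * t)) *: resolvent t).
Local Notation I := resolvent_fourier.

Lemma ccont_character (k : int) : ccont (fun t : R => expi (- (k%:~R * t))).
Proof.
have := @ccont_expi R (- k%:~R); congr ccont.
by apply/funext => t; rewrite mulNr.
Qed.

Lemma mxcont_fourier q (k : int) (f : R -> 'M[C]_q) : mxcont f ->
  mxcont (fun t => expi (- (k%:~R * t)) *: f t).
Proof. by move=> cf t; apply: mxcvgZ; [exact: ccont_character|exact: cf]. Qed.

(** Integrate [R = 1 + l B R]; multiplying by [l] shifts the index. *)
Lemma resolvent_fourierS (k : int) :
  I k = cint `[0, 2 * pi] (fun t => expi (- (k%:~R * t))) *: 1%:M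
        + B *m I (k - 1).
Proof.
rewrite -mx_integralZr; last exact: ccont_character.
rewrite -[X in _ + X]mulmx1 -mx_integral_mul; last first.
  exact/mxcont_fourier/mxcont_resolvent.
rewrite -mx_integralD.
- congr mx_integral; apply/funext => t; rewrite mulmx1 {1}resolventE scalerDr.
  congr (_ + _); rewrite -!scalemxAr scalerA -expiD; congr (expi _ *: _).
  by rewrite rmorphB /= mulrBl mul1r opprB addrC.
- by move=> t; apply: mxcvgZ; [exact: ccont_character|exact: mxcvg_cst].
- move=> t; apply: mxcvgM; last exact: mxcvg_cst.
  apply: mxcvgM; first exact: mxcvg_cst.
  exact: (mxcont_fourier (k - 1) mxcont_resolvent).
Qed.

Lemma twopi_ge0 : 0 <= 2 * pi :> R.
Proof. by rewrite mulr_ge0 // pi_ge0. Qed.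

Lemma resolvent_fourier_bounded :
  exists M : R, forall k i j, `|I k i j| <= M%:C.
Proof.
have [M _ fM] := mxcont_bounded twopi_ge0 mxcont_resolvent.
exists (2 * M * (2 * pi - 0)) => k i j; rewrite mx_integralE.
apply: cint_norm_le; first exact: twopi_ge0.
  exact/(mxcont_entry i j)/mxcont_fourier/mxcont_resolvent.
by move=> t t02; rewrite mxE normrM norm_expi mul1r; apply: fM.
Qed.

Lemma col_mulmx k q s (X : 'M[C]_(k, q)) (Y : 'M[C]_(q, s)) j :
  col j (X *m Y) = X *m col j Y.
Proof. by rewrite !colE mulmxA. Qed.

(** The coefficients of negative index form a bounded backward orbit of [B].
    This stands in for the classical argument that the resolvent is analytic in
    the closed disc, so that its boundary values have no negative frequencies. *)
Lemma resolvent_fourier_neg (k : nat) : I (- k.+1%:Z) = 0.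
Proof.
have [M IM] := resolvent_fourier_bounded.
apply/matrixP => i j; rewrite [RHS]mxE.
have IS r : I (- (k + r).+1%:Z) = B *m I (- (k + r.+1).+1%:Z).
  rewrite resolvent_fourierS cint_expi ?oppr_eq0 // scale0r add0r.
  by congr (_ *m I _); rewrite addnS -[in RHS]addn1 PoszD opprD.
pose x r := col j (I (- (k + r).+1%:Z)).
suff x0 : x 0 = 0.
  by have /colP/(_ i) := x0; rewrite /x addn0 [LHS]mxE [RHS]mxE.
apply: (bounded_backward_orbit_eq0 G_posdef shift_G (x := x) (M := M)).
  by move=> r; rewrite /x {1}IS col_mulmx.
by move=> r s; rewrite /x [X in `|X|]mxE.
Qed.

Lemma resolvent_fourier0 : I 0 = (2 * pi)%:C *: 1%:M.
Proof.
rewrite resolvent_fourierS (resolvent_fourier_neg 0) mulmx0 addr0.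
by rewrite cint_expi0.
Qed.

Lemma resolvent_fourier_pos i k : (i + k <= n)%N ->
  (E i) ^t* *m G *m I k%:Z = (2 * pi)%:C *: ((E (i + k)) ^t* *m G).
Proof.
elim: k i => [|k IH] i ikn.
  by rewrite resolvent_fourier0 -scalemxAr mulmx1 addn0.
rewrite resolvent_fourierS cint_expi // scale0r add0r mulmxA.
rewrite (companion_shift G_posdef (@adj_blockcol0_blockcol0 R p n) shift_G
   (X' := E i.+1)).
- have -> : k.+1%:Z - 1 = k%:Z by rewrite -addn1 PoszD addrK.
  by rewrite IH addSnnS.
- rewrite blockshift_blockcolS //.
  by apply: leq_trans ikn; rewrite addnS ltnS leq_addr.
- by rewrite mul_adj_blockcol.
Qed.

Lemma resolvent_moment (k : nat) : (k <= n)%N ->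
  (E 0) ^t* *m G *m I k%:Z *m E 0 = (2 * pi)%:C *: h k%:Z.
Proof.
move=> kn; rewrite resolvent_fourier_pos // -scalemxAl; congr (_ *: _).
by rewrite -[RHS](congr1 h (subr0 k%:Z)); apply: adj_blockcol_toeplitz.
Qed.

Lemma DeltaE_resolvent (t : R) :
  Eplus G (expi t) *m (Eplus G (expi t)) ^t* \in unitmx /\
  DeltaE G t =
  (E 0) ^t* *m (G *m resolvent t + (resolvent t) ^t* *m G - G) *m E 0.
Proof.
exact: (corner_spectral_density G_posdef (@adj_blockcol0_blockcol0 R p n)
  shift_G (norm_expi t) (mulmxV (resolvent_unit t)) (Fmx_blockcol0 _)
  (Fmx_shift _)).
Qed.

Lemma mxcont_DeltaE : mxcont (DeltaE G).
Proof.
have -> : DeltaE G = fun t =>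
    (E 0) ^t* *m (G *m resolvent t + (resolvent t) ^t* *m G - G) *m E 0.
  by apply/funext => t; have [] := DeltaE_resolvent t.
have cr := mxcont_resolvent.
have cGr : mxcont (fun t => G *m resolvent t).
  by move=> t; apply: mxcvgM; [exact: mxcvg_cst|exact: cr].
have crG : mxcont (fun t => (resolvent t) ^t* *m G).
  by move=> t; apply: mxcvgM; [apply: mxcvg_adj; exact: cr|exact: mxcvg_cst].
move=> t; apply: mxcvgM; last exact: mxcvg_cst.
apply: mxcvgM; first exact: mxcvg_cst.
apply: mxcvgD; last exact: mxcvg_cst.
by apply: mxcvgD; [exact: cGr|exact: crG].
Qed.

(** Integrates the three terms of [G R + R^* G - G]; taking adjoints exchanges
    the indices [k] and [- k]. *)
Lemma DeltaE_moment_resolvent (k : int) :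
  mx_integral `[0, 2 * pi] (fun t => expi (- (k%:~R * t)) *: DeltaE G t)
  = (E 0) ^t* *m G *m I k *m E 0 + ((E 0) ^t* *m G *m I (- k) *m E 0) ^t*
    - cint `[0, 2 * pi] (fun t => expi (- (k%:~R * t))) *: h 0.
Proof.
have adjG : G ^t* = G by case: G_posdef => /hermsymmxP.
have cI l := mxcont_fourier l mxcont_resolvent.
have -> : (fun t => expi (- (k%:~R * t)) *: DeltaE G t) = fun t =>
    ((E 0) ^t* *m G *m (expi (- (k%:~R * t)) *: resolvent t) *m E 0 +
     ((E 0) ^t* *m G *m (expi (- ((- k)%:~R * t)) *: resolvent t) *m E 0) ^t*)
    + expi (- (k%:~R * t)) *: (- h 0).
  apply/funext => t; have [_ ->] := DeltaE_resolvent t.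
  have <- : (E 0) ^t* *m G *m E 0 = h 0 by rewrite adj_blockcol_toeplitz.
  rewrite !adjmxM trmxCK adjmxZ conj_expi adjG mulrNz mulNr opprK.
  rewrite mulmxBr mulmxBl mulmxDr mulmxDl scalerBr scalerDr scalerN.
  by rewrite -!scalemxAl -!scalemxAr -!scalemxAl !mulmxA.
have cE l : mxcont (fun t =>
    (E 0) ^t* *m G *m (expi (- (l%:~R * t)) *: resolvent t) *m E 0).
  move=> t; apply: mxcvgM; last exact: mxcvg_cst.
  by apply: mxcvgM; [exact: mxcvg_cst|exact: cI].
rewrite mx_integralD; last 2 first.
- by move=> t; apply: mxcvgD; [exact: cE|apply: mxcvg_adj; exact: cE].
- by move=> t; apply: mxcvgZ; [exact: ccont_character|exact: mxcvg_cst].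
rewrite mx_integralZr ?scalerN; last exact: ccont_character.
congr (_ - _); rewrite mx_integralD; last 2 first.
- exact: cE.
- by move=> t; apply: mxcvg_adj; exact: cE.
rewrite (mx_integral_adj _ _ (cE (- k))).
by congr (_ + _ ^t*); apply: (mx_integral_mul _ _ _ _ (cI _)).
Qed.

Lemma adj_toeplitz_entry (k : nat) : (k <= n)%N -> (h k%:Z) ^t* = h (- k%:Z).
Proof.
move=> kn; have adjG : G ^t* = G by case: G_posdef => /hermsymmxP.
have <- : (E k) ^t* *m G *m E 0 = h k%:Z.
  by rewrite -[RHS](congr1 h (subr0 k%:Z)); apply: adj_blockcol_toeplitz.
rewrite !adjmxM trmxCK adjG mulmxA -[RHS](congr1 h (sub0r k%:Z)).
exact: adj_blockcol_toeplitz.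
Qed.

(** For [k > 0] only the first of the three terms survives and for [k < 0] only
    the second; for [k = 0] each of the three is [2 pi h_0], the last one with a
    minus sign. *)
Lemma DeltaE_moment (k : int) : - n%:Z <= k <= n%:Z ->
  mx_integral `[0, 2 * pi] (fun t => expi (- (k%:~R * t)) *: DeltaE G t)
  = (2 * pi)%:C *: h k.
Proof.
have adjZ (X : 'M[C]_p) : ((2 * pi)%:C *: X) ^t* = (2 * pi)%:C *: X ^t*.
  by rewrite adjmxZ; congr (_ *: _); apply: conjc_real.
rewrite DeltaE_moment_resolvent; case: k => [[|k]|k] /andP[lek kle].
- rewrite oppr0 resolvent_moment // adjZ adj_toeplitz_entry // oppr0.
  by rewrite cint_expi0 addrK.
- rewrite resolvent_fourier_neg mulmx0 mul0mx trmx0 map_mx0 addr0.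
  by rewrite cint_expi // scale0r subr0 resolvent_moment.
- have kn : (k.+1 <= n)%N by move: lek; rewrite NegzE lerN2.
  rewrite NegzE opprK resolvent_fourier_neg mulmx0 mul0mx add0r.
  rewrite cint_expi ?oppr_eq0 // scale0r subr0 resolvent_moment //.
  by rewrite adjZ adj_toeplitz_entry.
Qed.

End ToeplitzResolvent.

(** * Primitives of positive matrix functions and Riemann-Stieltjes sums *)

Section StieltjesIntegral.
Variable R : realType.
Local Notation C := R[i].

Lemma possemidefmx_integral q (f : R -> 'M[C]_q) a b : mxcont f ->
  (forall t, possemidefmx (f t)) -> possemidefmx (mx_integral `[a, b] f).
Proof.
move=> cf pf; split.
  apply/hermsymmxP; rewrite -mx_integral_adj //; congr mx_integral.
  by apply/funext => t; case: (pf t) => /hermsymmxP.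
move=> v; rewrite -mx_integral_mul // mx_integralE; apply: cint_ge0 => t.
by case: (pf t).
Qed.

Lemma possemidefmx_inv_gram q (A : 'M[C]_q) : A *m A ^t* \in unitmx ->
  possemidefmx (invmx (A *m A ^t*)).
Proof.
set M := A *m A ^t* => uM.
have adjM : M ^t* = M by rewrite adjmxM trmxCK.
have adjIM : (invmx M) ^t* = invmx M by rewrite adjmx_inv adjM.
split; first exact/hermsymmxP.
move=> v; have -> : v ^t* *m invmx M *m v
    = (invmx M *m v) ^t* *m ((A ^t*) ^t* *m A ^t*) *m (invmx M *m v).
  by rewrite adjmxM adjIM trmxCK -[RHS]mulmxA (mulKVmx uM).
by rewrite quad_sqr; apply: sumr_ge0 => i _; rewrite exprn_ge0.
Qed.

Lemma submxE k q (A B : 'M[C]_(k, q)) i j : (A - B) i j = A i j - B i j.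
Proof. by rewrite mxE [X in _ + X]mxE. Qed.

Lemma mx_integral_itvB q (f : R -> 'M[C]_q) x y z : mxcont f -> x <= y -> y <= z ->
  mx_integral `[x, z] f - mx_integral `[x, y] f = mx_integral `[y, z] f.
Proof.
move=> cf xy yz; apply/matrixP => i j; rewrite submxE !mx_integralE.
by apply: cint_itvB => //; exact: mxcont_entry.
Qed.

Lemma cint_cell_le (f g : R -> C) (L M d x y xi : R) :
  ccont f -> ccont g -> 0 <= L -> 0 <= x -> x <= xi <= y -> y - x < d ->
  (forall s t, `|f s - f t| <= (L * `|s - t|)%:C) ->
  (forall t, x <= t <= y -> `|g t| <= M%:C) ->
  `|f xi * (cint `[0, y] g - cint `[0, x] g)
    - (cint `[0, y] (fun t => f t * g t) - cint `[0, x] (fun t => f t * g t))|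
  <= (2 * (L * d * M) * (y - x))%:C.
Proof.
move=> cf cg L0 x0 /andP[xxi xiy] yxd fL gM; have xy := le_trans xxi xiy.
have cfg : ccont (fun t => f t * g t) by move=> t; apply: ccvgM.
rewrite !cint_itvB // -cintZ //.
have cfxg : ccont (fun t => f xi * g t).
  by move=> t; apply: ccvgM => //; apply: ccvg_cst.
have -> : cint `[x, y] (fun t => f xi * g t) - cint `[x, y] (fun t => f t * g t)
    = cint `[x, y] (fun t => (f xi - f t) * g t).
  rewrite -mulN1r -cintZ // -cintD //; last first.
    by move=> t; apply: ccvgM => //; apply: ccvg_cst.
  by congr cint; apply/funext => t; rewrite mulN1r mulrBl.
apply: cint_norm_le => // [t|t /andP[xt ty]].
  apply: ccvgM => //; apply: ccvgD; first exact: ccvg_cst.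
  have -> : - f t = -1 * f t by rewrite mulN1r.
  under eq_fun do rewrite -mulN1r.
  by apply: ccvgM => //; apply: ccvg_cst.
rewrite normrM rmorphM; apply: ler_pM => //; last by apply: gM; rewrite xt.
apply: le_trans (fL _ _) _; rewrite lecR ler_wpM2l // ler_norml; lra.
Qed.

(** A Lipschitz integrand is within [L d] of its value at the tag on a cell of
    length less than [d], so the Riemann-Stieltjes sums against the primitive of
    [D] converge to the integral of [f D]. *)
Lemma is_RS_integral_primitive q (f : R -> C) (D : R -> 'M[C]_q) (L b : R) :
  0 <= b -> 0 <= L -> ccont f -> mxcont D ->
  (forall s t, `|f s - f t| <= (L * `|s - t|)%:C) ->
  is_RS_integral 0 b f (fun t => mx_integral `[0, t] D)
    (mx_integral `[0, b] (fun t => f t *: D t)).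
Proof.
move=> b0 L0 cf cD fL e e0.
have [M M0 DM] := mxcont_bounded b0 cD.
pose K := 2 * (L * M) * b.
have K0 : 0 <= K by rewrite !mulr_ge0.
(* The error is at most [K d]; adding 1 to [K] avoids a division by zero and
   makes the bound strict. *)
exists (e / (K + 1)) => [|s xi x part tag i j].
  by rewrite divr_gt0 // ltr_wpDl.
set d := e / (K + 1) in tag.
pose g t := D t i j.
have cg : ccont g by exact: mxcont_entry.
pose S y := cint `[0, y] g; pose P y := cint `[0, y] (fun t => f t * g t).
have xge0 k : (k < (size s).+1)%N -> 0 <= x k.
  by move=> ks; apply: itv_partition_nth_ge part.
have xleb k : (k < (size s).+1)%N -> x k <= b.
  by move=> ks; apply: itv_partition_nth_le part.
have x0 : x 0 = 0 by [].
have xs : x (size s) = b by apply: itv_partition_nth_size part.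
have P0 : P 0 = 0 by rewrite /P /cint set_itv1 !Rintegral_set1.
have -> : mx_integral `[0, b] (fun t => f t *: D t) i j
    = \sum_(k < size s) (P (x k.+1) - P (x k)).
  rewrite -(big_mkord xpredT (fun k => P (x k.+1) - P (x k))).
  rewrite telescope_sumr // xs x0 P0 subr0 mx_integralE.
  by congr cint; apply/funext => t; rewrite mxE.
rewrite summxE -sumrB.
apply: le_lt_trans (ler_norm_sum _ _ _) _.
have cell (k : 'I_(size s)) :
    `|(f (xi k) *: (mx_integral `[0, x k.+1] D - mx_integral `[0, x k] D)) i j
       - (P (x k.+1) - P (x k))| <= (2 * (L * d * M) * (x k.+1 - x k))%:C.
  have [xik xd] := tag k (ltn_ord k).
  rewrite [X in `|X - _|]mxE submxE !mx_integralE.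
  apply: cint_cell_le => //; first by apply: xge0; rewrite ltnS ltnW.
  move=> t /andP[xt tx]; apply: DM; rewrite (le_trans _ xt) ?xge0 ?ltnS 1?ltnW //.
  by rewrite (le_trans tx) // xleb // ltnS.
apply: le_lt_trans (ler_sum _ (fun k _ => cell k)) _.
rewrite -rmorph_sum -mulr_sumr ltcR.
rewrite -(big_mkord xpredT (fun k => x k.+1 - x k)) telescope_sumr // xs x0 subr0.
have -> : 2 * (L * d * M) * b = K * d by rewrite /K; ring.
rewrite /d mulrCA -ltr_pdivlMl // mulVf ?gt_eqF //.
by rewrite ltr_pdivrMr ?ltr_wpDl // mul1r ltrDl.
Qed.

End StieltjesIntegral.

(** * The truncated trigonometric moment problem *)

Theorem corollary3p5 (R : realType) (p n : nat) (h : int -> 'M[R[i]]_p)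
    (p_ge1 : (1 <= p)%N) (n_ge1 : (1 <= n)%N)
    (G_posdef : posdefmx (block_toeplitz n h)) :
  let G := block_toeplitz n h in
  (forall t : R, 0 <= t <= 2 * pi ->
     Eplus G (expi t) *m (Eplus G (expi t)) ^t* \in unitmx) /\
  (forall k : int, - n%:Z <= k <= n%:Z ->
     let f := fun t : R => expi (- (k%:~R * t)) *: DeltaE G t in
     mx_integrable `[0, 2 * pi] f /\
     ((2 * pi)^-1)%:C *: mx_integral `[0, 2 * pi] f = h k) /\
  trig_moment_solution n h (fun t : R => mx_integral `[0, t] (DeltaE G)).
Proof.
move=> G; have cD := mxcont_DeltaE G_posdef.
have pi2 : (2 * pi)^-1%:C * (2 * pi)%:C = 1 :> R[i].
  by rewrite -rmorphM mulVf ?mulf_neq0 // gt_eqF // pi_gt0.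
have moment k : - n%:Z <= k <= n%:Z -> ((2 * pi)^-1)%:C *:
    mx_integral `[0, 2 * pi] (fun t => expi (- (k%:~R * t)) *: DeltaE G t) = h k.
  by move=> kn; rewrite DeltaE_moment // scalerA pi2 scale1r.
split; first by move=> t _; have [] := DeltaE_resolvent G_posdef t.
split=> [k kn f|]; first by split; [exact/mxcont_integrable/mxcont_fourier|exact: moment].
split=> [s t s0 st _|k kn].
  rewrite mx_integral_itvB //; apply: possemidefmx_integral => // u.
  by apply: possemidefmx_inv_gram; have [] := DeltaE_resolvent G_posdef u.
exists (mx_integral `[0, 2 * pi] (fun t => expi (- (k%:~R * t)) *: DeltaE G t)).
  apply: (@is_RS_integral_primitive _ _ _ _ (2 * `|- k%:~R|)) => //.
  - exact: twopi_ge0.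
  - exact: ccont_character.
  - by move=> s t; rewrite -!mulNr; apply: expi_lipschitz.
exact: moment.
Qed.
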